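(* Put $G=\mathbb{R}_{>0}$ (the multiplicative group) and $H=\{1\}$. For $\lambda\in\mathbb{R}$, denote by $\rho_\lambda\colon G\to\mathbb{R}^\times=GL(\mathbb{R})$ the representation given by $\rho_\lambda(x)=x^\lambda$. Then $v_0:=1\in\mathbb{R}$ is $H$-fixed, and the family $\mathcal{P}$ obtained from $G$, $H$, $\rho_\lambda$, $v_0$ by the method described in the context is the following family of distributions on $\mathbb{R}_{>0}$: $$\left\{\frac{|\lambda|}{\Gamma(k)}\left(\frac{x}{\theta}\right)^{k\lambda}e^{-\left(\frac{x}{\theta}\right)^\lambda}\frac{dx}{x}\right\}_{(k,\theta)\in\mathbb{R}_{>0}\times\mathbb{R}_{>0}}.$$ In particular, one obtains the family of gamma distributions if $\lambda=1$ and the family of inverse gamma distributions if $\lambda=-1$: $$\left\{\frac{1}{\Gamma(k)}\left(\frac{x}{\theta}\right)^{k}e^{-\frac{x}{\theta}}\frac{dx}{x}\right\}_{(k,\theta)\in\mathbb{R}_{>0}\times\mathbb{R}_{>0}}\ (\lambda=1),\qquad\left\{\frac{1}{\Gamma(k)}\left(\frac{\theta}{x}\right)^{k}e^{-\frac{\theta}{x}}\frac{dx}{x}\right\}_{(k,\theta)\in\mathbb{R}_{>0}\times\mathbb{R}_{>0}}\ (\lambda=-1).$$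
   Context: $dx$ is Lebesgue measure on $\mathbb{R}_{>0}$ and $\Gamma$ is the gamma function. The method: let $G$ be a Lie group with finitely many connected components, $H$ a closed subgroup, $X:=G/H$, $\rho\colon G\to GL(V)$ a continuous finite dimensional real representation and $v_0\in V$ an $H$-fixed vector. Put $W_0(G,H):=\{\tau\colon G\to\mathbb{R}\mid\tau\text{ is a continuous group homomorphism with }\tau|_H=0\}$. Take a nonzero relatively $G$-invariant Radon measure $\nu$ on $X$ (i.e. for some $\chi\colon G\to\mathbb{R}_{>0}$ the pushforward satisfies $g\cdot\nu=\chi(g)^{-1}\nu$ for all $g\in G$), assumed to exist; the resulting family does not depend on the choice of $\nu$. For $\vartheta=(\varphi,\tau)\in V^\vee\times W_0(G,H)$ (where $V^\vee$ is the dual space of $V$) and $x=gH$, put $\rho(x)v_0:=\rho(g)v_0$, $\tau(x):=\tau(g)$ and $d\tilde p_\vartheta(x):=\exp(-\langle\varphi,\rho(x)v_0\rangle+\tau(x))\,d\nu(x)$. Let $\Theta:=\{\vartheta\in V^\vee\times W_0(G,H)\mid\int_Xd\tilde p_\vartheta<\infty\}$ and, for $\vartheta\in\Theta$, $p_\vartheta:=(\int_Xd\tilde p_\vartheta)^{-1}\tilde p_\vartheta$. The family obtained is the set $\mathcal{P}:=\{p_\vartheta\}_{\vartheta\in\Theta}$ of probability measures on $X$.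
   Formalization: For λ=0 the displayed expression is the zero measure, while the method gives the empty family, so the stated equality fails; here the displayed family is taken to contain only probability measures, so that both sides are empty at λ=0. *)

(* Defs.v *)
From HB Require Import structures.
From mathcomp Require Import all_boot all_order all_algebra.
From mathcomp Require Import all_classical all_reals all_analysis.

Set Implicit Arguments.
Unset Strict Implicit.
Unset Printing Implicit Defensive.

Import Order.TTheory GRing.Theory Num.Theory.
Import numFieldTopology.Exports numFieldNormedType.Exports.

Local Open Scope classical_set_scope.
Local Open Scope ring_scope.

HB.mixin Record isTopologicalGroup G & Group G & Topological G := {
  mulg_continuous : continuous (fun xy : G * G => (xy.1 * xy.2)%g);
  invg_continuous : continuous (fun x : G => (x^-1)%g)
}.

(* Pointedness is what the library asks of a measurable type; the choice of the
   base point is irrelevant. *)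
#[short(type="topologicalGroupType")]
HB.structure Definition TopologicalGroup :=
  {G of Group G & PointedTopological G & isTopologicalGroup G}.

Record closedSubgroup (G : topologicalGroupType) := ClosedSubgroup {
  subgroup_set :> set G;
  subgroup1 : subgroup_set 1%g;
  subgroupM : forall x y, subgroup_set x -> subgroup_set y ->
    subgroup_set (x * y)%g;
  subgroupV : forall x, subgroup_set x -> subgroup_set (x^-1)%g;
  subgroup_closed : closed subgroup_set
}.

(* The measurable space of Borel sets of a topological space T. *)
Notation borel T := (g_sigma_algebraType (@open T)).

Section homogeneous_space.
Variables (G : topologicalGroupType) (H : closedSubgroup G).

Definition lcoset_rel : rel G := fun x y => `[< subgroup_set H (x^-1 * y)%g >].

Lemma lcoset_rel_refl : reflexive lcoset_rel.
Proof. by move=> x; apply/asboolP; rewrite mulVg; exact: subgroup1. Qed.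

Lemma lcoset_rel_sym : symmetric lcoset_rel.
Proof.
by move=> x y; apply/asboolP/asboolP => /subgroupV; rewrite invgM invgK.
Qed.

Lemma lcoset_rel_trans : transitive lcoset_rel.
Proof.
move=> y x z /asboolP xy /asboolP yz; apply/asboolP.
by have := subgroupM xy yz; rewrite mulgA mulgK.
Qed.

Canonical lcoset_equiv :=
  EquivRel lcoset_rel lcoset_rel_refl lcoset_rel_sym lcoset_rel_trans.

(* G / H: left cosets, with the quotient topology *)
Definition homogeneous_space := quotient_topology {eq_quot lcoset_equiv}%qT.

HB.instance Definition _ := PointedTopological.on homogeneous_space.
HB.instance Definition _ := Quotient.on homogeneous_space.

Definition coset_pi (g : G) : homogeneous_space :=
  (\pi_homogeneous_space g)%qT.

Definition coset_act (g : G) (x : homogeneous_space) : homogeneous_space :=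
  coset_pi (g * repr x)%g.

End homogeneous_space.

Section relatively_invariant.
Local Open Scope ereal_scope.
Variable R : realType.

Definition radon (T : ptopologicalType) (nu : set T -> \bar R) :=
  [/\ forall K : set T, compact K -> nu K < +oo,
      forall A : set (borel T), measurable A ->
        nu A = ereal_inf [set nu U | U in [set U | open U /\ A `<=` U]]
    & forall U : set T, open U ->
        nu U = ereal_sup [set nu K | K in [set K | compact K /\ K `<=` U]]].

Variables (G : topologicalGroupType) (H : closedSubgroup G).
Local Notation X := (borel (homogeneous_space H)).

Definition relatively_invariant (nu : set X -> \bar R) :=
  exists2 chi : G -> R, (forall g, 0 < chi g)%R &
    forall g (A : set X), measurable A ->
      pushforward nu (coset_act g : X -> X) A = (chi g)^-1%:E * nu A.

(* nonzero relatively G-invariant Radon measures on G / H *)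
Definition admissible (nu : {measure set X -> \bar R}) :=
  [/\ nu setT != 0, radon nu & relatively_invariant nu].

End relatively_invariant.

Section method.
Variables (R : realType) (G : topologicalGroupType) (H : closedSubgroup G).
Local Notation X := (borel (homogeneous_space H)).

(* Continuous representations on V = R^n; being multiplicative and unital, rho
   takes its values in GL(V). *)
Definition continuous_rep n (rho : G -> 'M[R]_n) :=
  [/\ rho 1%g = 1%:M,
      forall x y, rho (x * y)%g = rho x *m rho y
    & continuous rho].

Definition fixed_vector n (rho : G -> 'M[R]_n) (v : 'cV[R]_n) :=
  forall h, subgroup_set H h -> rho h *m v = v.

Definition W0 : set (G -> R) :=
  [set tau | [/\ continuous tau,
                 forall x y, tau (x * y)%g = tau x + tau y
               & forall h, subgroup_set H h -> tau h = 0]].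

Variables (nu : {measure set X -> \bar R}).
Variables (n : nat) (rho : G -> 'M[R]_n) (v0 : 'cV[R]_n).

Local Notation dual := {linear 'cV[R]_n -> R^o}.

(* For v0 fixed by H and tau in W0 the value at x = gH does not depend on the
   choice of the representative g of x. *)
Definition method_density (phi : dual) (tau : G -> R) (x : X) : R :=
  expR (- phi (rho (repr x) *m v0) + tau (repr x)).

Definition method_unnormalized (vt : dual * (G -> R)) (A : set X) : \bar R :=
  (\int[nu]_(x in A) (method_density vt.1 vt.2 x)%:E)%E.

Definition method_Theta : set (dual * (G -> R)) :=
  [set vt | W0 vt.2 /\ (method_unnormalized vt setT < +oo)%E].

Definition method_p (vt : dual * (G -> R)) (A : set X) : \bar R :=
  (((fine (method_unnormalized vt setT))^-1)%:E * method_unnormalized vt A)%E.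

(* Measures of the library are functions on all subsets, whence the comparison
   on measurable sets only. *)
Definition method_family : set (probability X R) :=
  [set p | exists2 vt, method_Theta vt &
     forall A : set X, measurable A -> p A = method_p vt A].

End method.

(* The identification of G with G / {1}: the distributions q on G which
   correspond to a member p of P under g |-> gH. *)
Definition on_group (R : realType) (G : topologicalGroupType)
    (H : closedSubgroup G) (P : set (probability (borel (homogeneous_space H)) R))
    : set (probability (borel G) R) :=
  [set q | exists2 p, P p &
     forall B : set (borel (homogeneous_space H)), measurable B ->
       p B = pushforward q
         (@coset_pi G H : borel G -> borel (homogeneous_space H)) B].

Section positive_reals.
Variable R : realType.

Definition posreal : Type := {x : R | 0 < x}.
Definition posval (x : posreal) : R := val x.
Definition posmk (x : R) (x0 : 0 < x) : posreal := exist _ x x0.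

Lemma posval_gt0 (x : posreal) : 0 < posval x. Proof. exact: valP. Qed.
Lemma posval_neq0 (x : posreal) : posval x != 0.
Proof. exact: lt0r_neq0 (posval_gt0 x). Qed.

HB.instance Definition _ := Choice.on posreal.
HB.instance Definition _ :=
  Topological.copy posreal (initial_topology posval).

Definition pos1 : posreal := posmk ltr01.
Definition posM (x y : posreal) : posreal :=
  posmk (mulr_gt0 (posval_gt0 x) (posval_gt0 y)).

Lemma posV_subproof (x : posreal) : 0 < (posval x)^-1.
Proof. by rewrite invr_gt0 posval_gt0. Qed.
Definition posV (x : posreal) : posreal := posmk (posV_subproof x).

HB.instance Definition _ := isPointed.Build posreal pos1.

Lemma posMA : associative posM.
Proof. by move=> x y z; apply/val_inj/mulrA. Qed.
Lemma pos1M : left_id pos1 posM.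
Proof. by move=> x; apply/val_inj/mul1r. Qed.
Lemma posM1 : right_id pos1 posM.
Proof. by move=> x; apply/val_inj/mulr1. Qed.
Lemma posVM : left_inverse pos1 posV posM.
Proof. by move=> x; apply/val_inj/mulVf/posval_neq0. Qed.
Lemma posMV : right_inverse pos1 posV posM.
Proof. by move=> x; apply/val_inj/mulfV/posval_neq0. Qed.

HB.instance Definition _ :=
  isGroup.Build posreal posMA pos1M posM1 posVM posMV.

Lemma posval_continuous : continuous posval.
Proof. exact: initial_continuous. Qed.

Lemma posreal_cvg (T : topologicalType) (f : T -> posreal) :
  continuous (posval \o f) -> continuous f.
Proof.
move=> cf; apply/continuousP => _ [A oA <-].
by rewrite -comp_preimage; move/continuousP : cf; exact.
Qed.

Lemma posM_continuous :
  continuous (fun xy : posreal * posreal => (xy.1 * xy.2)%g).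
Proof.
apply: posreal_cvg => xy.
apply: (@cvgM _ _ (nbhs xy) _ (posval \o fst) (posval \o snd)).
  by apply: continuous_comp; [exact: cvg_fst|exact: posval_continuous].
by apply: continuous_comp; [exact: cvg_snd|exact: posval_continuous].
Qed.

Lemma posV_continuous : continuous (fun x : posreal => (x^-1)%g).
Proof.
apply: posreal_cvg => x.
exact: (@cvgV _ _ (nbhs x) _ _ _ (posval_neq0 x) (@posval_continuous x)).
Qed.

HB.instance Definition _ :=
  isTopologicalGroup.Build posreal posM_continuous posV_continuous.

End positive_reals.

Section gamma_families.
Variable R : realType.

Let G : topologicalGroupType := posreal R.

Lemma triv_closed : closed [set 1%g : G].
Proof.
have -> : [set 1%g : G] = @posval R @^-1` [set 1].
  by apply/seteqP; split => [_ -> //|x /= x1]; exact/val_inj.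
apply: preimage_closed; first by move=> x _; exact: posval_continuous.
exact: closed_eq.
Qed.

Definition triv : closedSubgroup G.
Proof.
exists [set 1%g : G] => //.
- by move=> _ _ -> ->; rewrite mulg1.
- by move=> _ ->; rewrite invg1.
- exact: triv_closed.
Defined.

Definition rho_lam (lam : R) (x : posreal R) : 'M[R]_1 :=
  (posval x `^ lam)%:M.

Definition v_one : 'cV[R]_1 := const_mx 1.

Definition Gamma (k : R) : R :=
  \int[lebesgue_measure]_(t in `]0%R, +oo[) (t `^ (k - 1) * expR (- t)).

(* f(x) dx on the positive reals *)
Definition dx_density (f : R -> R) (A : set (posreal R)) : \bar R :=
  (\int[lebesgue_measure]_(x in @posval R @` A) (f x)%:E)%E.

Definition has_density (q : probability (borel (posreal R)) R) (f : R -> R) :=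
  forall A : set (borel (posreal R)), measurable A -> q A = dx_density f A.

Definition density_family (f : R -> R -> R -> R) :
    set (probability (borel (posreal R)) R) :=
  [set q | exists k theta, [/\ 0 < k, 0 < theta & has_density q (f k theta)]].

(* The factor x^-1 comes from dx / x. *)
Definition gen_gamma_pdf (lam k theta x : R) : R :=
  `|lam| / Gamma k * (x / theta) `^ (k * lam)
    * expR (- (x / theta) `^ lam) * x^-1.

Definition gamma_pdf (k theta x : R) : R :=
  (Gamma k)^-1 * (x / theta) `^ k * expR (- (x / theta)) * x^-1.

Definition inv_gamma_pdf (k theta x : R) : R :=
  (Gamma k)^-1 * (theta / x) `^ k * expR (- (theta / x)) * x^-1.

End gamma_families.

(* Main.v *)
(* By uniqueness of the Haar measure of R_{>0}, an admissible nu corresponds to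
   c x^(s-1) dx for some c > 0 and real s, and a continuous homomorphism tau is
   b ln. Hence the unnormalized measures are c exp(- phi x^lam) x^(a-1) dx with
   a = b + s: the choice of nu is absorbed by b. In the coordinate t = ln x the
   density is exp(a t - phi e^(lam t)). If lam = 0, phi <= 0 or a / lam <= 0 it
   is bounded below by a positive constant on a half-line, so the mass is
   infinite; otherwise, with k = a / lam and phi = theta^(-lam), the mass is
   c Gamma(k) theta^(k lam) / |lam|. *)
Require Import Defs.
From HB Require Import structures.
From mathcomp Require Import all_boot all_order all_algebra.
From mathcomp Require Import all_classical all_reals all_analysis.
From mathcomp Require Import measurable_realfun ring lra.
Import Order.TTheory GRing.Theory Num.Theory.
Import numFieldTopology.Exports numFieldNormedType.Exports.
Local Open Scope classical_set_scope.
Local Open Scope ring_scope.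

Set SsrOldRewriteGoalsOrder.
Set Implicit Arguments.
Unset Strict Implicit.
Unset Printing Implicit Defensive.

(** In the definition of relative invariance [chi] is just a positive function: its multiplicativity
    and its form as a power have to be extracted from the finiteness of [nu] on compact sets. To
    this end [nu] is moved to the real line by the coordinate [coset_val], where it becomes a
    dilation-homogeneous measure that does not charge the nonpositive reals. Two tools then serve
    twice. Uniqueness of homogeneous measures, stated for integrals of nonnegative functions, is
    applied to [nu] and to the image of Lebesgue measure under the exponential, which gives the
    substitution x = e^t. Linearity of additive functions bounded above on [0, 1] is applied to ln
    [chi] and to [tau]. For [nu] the constant c is never computed: it cancels under normalization,
    and only its sign matters. *)

(** * Images of measures and affine substitution *)

(* The library's measure structure on a pushforward takes the measurability
   proof as an argument, which is not inferred; here it is explicit. *)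
Definition image_measure d d' (T1 : measurableType d) (T2 : measurableType d')
    (R : realFieldType) (m : {measure set T1 -> \bar R}) (f : T1 -> T2)
    (mf : measurable_fun setT f) : {measure set T2 -> \bar R} :=
  measure_function_pushforward__canonical__measure_function_Measure m mf.

Lemma image_measureE d d' (T1 : measurableType d) (T2 : measurableType d')
    (R : realFieldType) (m : {measure set T1 -> \bar R}) (f : T1 -> T2)
    (mf : measurable_fun setT f) A : image_measure m mf A = m (f @^-1` A).
Proof. by []. Qed.

Lemma ge0_integral_image d d' (T1 : measurableType d) (T2 : measurableType d')
    (R : realType) (m : {measure set T1 -> \bar R}) (f : T1 -> T2)
    (mf : measurable_fun setT f) (F : T2 -> \bar R) :
  measurable_fun setT F -> (forall y, 0 <= F y)%E ->
  (\int[image_measure m mf]_y F y = \int[m]_x F (f x))%E.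
Proof. by move=> mF F0; exact: ge0_integral_pushforward. Qed.

Section real_line.
Context {R : realType}.
Local Notation mu := (@lebesgue_measure R).
Local Notation TR := (measurableTypeR R).

Lemma measurable_affine (a b : R) : measurable_fun [set: TR] 
  (fun t : TR => a * t + b : TR).
Proof. by apply: measurable_funD => //; apply: measurable_funM. Qed.

(** Rescaled by |a|, the image of Lebesgue measure under t -> a t + b gives every interval ]x, y]
    its length, so uniqueness of Lebesgue measure applies. For a < 0 the preimage is half-open on
    the other side, whence the case split. *)
Lemma lebesgue_measure_affine (a b : R) (A : set TR) : a != 0 -> measurable A ->
  mu ((fun t => a * t + b) @^-1` A) = (`|a|^-1%:E * mu A)%E.
Proof.
move=> a0 mA.
have na0 : 0 < `|a| by rewrite normr_gt0.
pose f : TR -> TR := fun t => a * t + b.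
have mf : measurable_fun [set: TR] f by exact: measurable_affine.
pose k : {nonneg R} := NngNum (ltW na0).
pose M : {measure set TR -> \bar R} := mscale k (image_measure mu mf).
suff -> : mu A = M A.
  by rewrite /M /mscale/= muleA -EFinM mulVf ?gt_eqF// mul1e.
apply: lebesgue_measure_unique => // _ [[x y] _ <-].
rewrite lebesgue_measure_itv.
rewrite [RHS](_ : _ = (`|a|%:E * mu (f @^-1` `]x, y]%classic))%E)//=.
have [a_gt0|a_le0] := ltP 0 a.
  have -> : f @^-1` `]x, y] = `](x - b) / a, (y - b) / a]%classic.
    apply/seteqP; split => t; rewrite /= !in_itv/= /f;
    by rewrite ltr_pdivrMr // ler_pdivlMr// ltrBlDr lerBrDr (mulrC a).
  rewrite lebesgue_measure_itv/= !lte_fin ltr_pM2r ?invr_gt0// ltrD2r.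
  case: ifPn => _; last by rewrite mule0.
  by rewrite -!EFinB -EFinM gtr0_norm//; congr EFin; field.
have a_lt0 : a < 0 by rewrite lt_neqAle a0.
have -> : f @^-1` `]x, y] = `[(y - b) / a, (x - b) / a[%classic.
  apply/seteqP; split => t; rewrite /= !in_itv/= /f;
  by rewrite ltr_ndivlMr // ler_ndivrMr// ltrBlDr lerBrDr (mulrC a) andbC.
rewrite lebesgue_measure_itv/= !lte_fin ltr_nM2r ?invr_lt0// ltrD2r.
case: ifPn => _; last by rewrite mule0.
by rewrite -!EFinB -EFinM ltr0_norm//; congr EFin; field.
Qed.

Lemma ge0_integral_affine (a b : R) (F : R -> \bar R) : a != 0 ->
  measurable_fun [set: TR] F -> (forall x, 0 <= F x)%E ->
  (\int[mu]_t F (a * t + b)%R = `|a|^-1%:E * \int[mu]_t F t)%E.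
Proof.
move=> a0 mF F0.
have mf := measurable_affine a b.
have k0 : 0 <= `|a|^-1 by rewrite invr_ge0.
rewrite (_ : (`|a|^-1%:E)%E = ((NngNum k0)%:num)%:E%E)// -ge0_integral_mscale//.
rewrite -[LHS](@ge0_integral_image _ _ TR TR R mu _ mf F)//.
apply: eq_measure_integral => A mA _ /=.
by rewrite /mscale/= /pushforward lebesgue_measure_affine.
Qed.

(* f x - f 1 * x is additive and 1-periodic, hence bounded above on the whole
   line. *)
Lemma additive_bounded_above (f : R -> R) (C : R) :
  {morph f : x y / x + y} -> (forall x, 0 <= x <= 1 -> f x <= C) ->
  forall x, f x = f 1 * x.
Proof.
move=> fD fC.
have f0 : f 0 = 0.
  by have := fD 0 0; rewrite addr0 => /eqP; rewrite -subr_eq subrr => /eqP.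
have fN x : f (- x) = - f x by apply/eqP; rewrite -addr_eq0 -fD addNr f0.
have fMn x n : f (x *+ n) = f x *+ n.
  by elim: n => [|n IH]; rewrite ?mulr0n// !mulrS fD IH.
have fMz x (m : int) : f (x *~ m) = f x *~ m.
  by case: m => n; rewrite ?NegzE ?mulrNz ?fN -!pmulrn fMn.
pose d x := f x - f 1 * x.
have dC x : d x <= C + `|f 1|.
  rewrite /d -{1 2}(subrK (Num.floor x)%:~R x) fD fMz mulrDr.
  rewrite [in X in _ - X]mulrzr opprD addrACA subrr addr0 lerD//.
    apply: fC; rewrite subr_ge0 Num.Theory.ge_floor/= lerBlDr.
    by rewrite addrC ltW// -[_ + 1]/(_ + 1%:~R) -intrD Num.Theory.floorD1_gt.
  rewrite -mulrN (le_trans (ler_norm _))// normrM ler_piMr// normrN ger0_norm.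
    rewrite lerBlDr addrC ltW// -[_ + 1]/(_ + 1%:~R) -intrD.
    by rewrite Num.Theory.floorD1_gt.
  by rewrite subr_ge0 Num.Theory.ge_floor.
have dMn x n : d (x *+ n) = d x *+ n by rewrite /d fMn mulrnBl mulrnAr.
(* A positive value of [d] would exceed the bound at a large multiple of x. Applied at - x as well,
   this gives d = 0. *)
have d_le0 x : d x <= 0.
  rewrite leNgt; apply/negP => dx.
  have C0 : 0 <= C + `|f 1| by rewrite (le_trans _ (dC x))// ltW.
  have := dC (x *+ (Num.bound ((d x)^-1 * (C + `|f 1|)))).
  rewrite dMn -mulr_natr -ler_pdivlMl// leNgt => /negP; apply.
  by apply: archi_boundP; rewrite mulr_ge0// invr_ge0 ltW.
move=> x; apply/eqP; rewrite -subr_eq0 -/(d x) eq_le d_le0/=.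
by have := d_le0 (- x); rewrite /d fN mulrN -opprD oppr_le0.
Qed.

End real_line.

(** * Dilation-homogeneous measures on the positive reals *)

Section homogeneous_measure.
Context {R : realType}.
Local Notation mu := (@lebesgue_measure R).
Local Notation TR := (measurableTypeR R).

Lemma powR_window (p y : R) : 1 <= y <= 2 ->
  2 `^ (- `|p|) <= y `^ p <= 2 `^ `|p|.
Proof.
move=> /andP[y1 y2]; have y0 : 0 < y by exact: lt_le_trans y1.
apply/andP; split.
  rewrite (@le_trans _ _ (y `^ (- `|p|)))//; last first.
    by rewrite ler_powR// lerNl -normrN ler_norm.
  by rewrite !powRN lef_pV2 ?posrE ?powR_gt0// ge0_ler_powR// nnegrE// ltW.
rewrite (@le_trans _ _ (y `^ `|p|))// ?ler_powR ?ler_norm//.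
by rewrite ge0_ler_powR// nnegrE// ltW.
Qed.

(** The window has length 1 and the power lies between two positive constants on it. Only finiteness
    and positivity matter, since the value is divided out later. *)
Lemma integral_window_powR (p : R) :
  exists2 a : R, 0 < a &
    (\int[mu]_y (\1_(`[1%R, 2%R]%classic) y * y `^ p)%:E = a%:E)%E.
Proof.
set U := `[1%R, 2%R]%classic.
have mU : measurable (U : set TR) by exact: measurable_itv.
have muU : mu U = 1%E.
  by rewrite lebesgue_measure_itv/= lte_fin ltr1n -EFinD; congr EFin; lra.
have mf : measurable_fun [set: TR] (fun y : TR => (\1_U y * y `^ p)%:E).
  apply/measurable_EFinP; apply: measurable_funM; first exact: measurable_indic.
  exact: measurable_powR.
have mc c : measurable_fun [set: TR] (fun y : TR => (c * \1_U y)%:E : \bar R).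
  by apply/measurable_EFinP; apply: measurable_funM => //;
    exact: measurable_indic.
have intc c : 0 <= c -> (\int[mu]_y (c * \1_U y)%:E = c%:E)%E.
  move=> c0; under eq_integral do rewrite EFinM.
  rewrite ge0_integralZl_EFin//; last first.
    by apply/measurable_EFinP; exact: measurable_indic.
  by rewrite -[RHS]mule1 -[in RHS]muU integral_indic// setIT.
have Uwin y : U y -> 2 `^ (- `|p|) <= y `^ p <= 2 `^ `|p|.
  by rewrite /U/= in_itv/=; exact: powR_window.
have lo : ((2 `^ (- `|p|))%:E <= \int[mu]_y (\1_U y * y `^ p)%:E)%E.
  rewrite -[leLHS]intc ?powR_ge0//; apply: ge0_le_integral => //.
  move=> y _; rewrite lee_fin indicE; case: (boolP (y \in U)) => [|_];
    last by rewrite !(mulr0,mul0r).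
    by rewrite inE => /Uwin/andP[? ?]; rewrite /= mulr1 mul1r.
have hi : (\int[mu]_y (\1_U y * y `^ p)%:E <= (2 `^ `|p|)%:E)%E.
  rewrite -[leRHS]intc ?powR_ge0//; apply: ge0_le_integral => //.
    by move=> y _; rewrite lee_fin mulr_ge0// powR_ge0.
  move=> y _; rewrite lee_fin indicE; case: (boolP (y \in U)) => [|_];
    last by rewrite !(mulr0,mul0r).
    by rewrite inE => /Uwin/andP[? ?]; rewrite /= mulr1 mul1r.
have fn : (\int[mu]_y (\1_U y * y `^ p)%:E)%E \is a fin_num.
  rewrite ge0_fin_numE; first by rewrite (le_lt_trans hi)// ltry.
  by rewrite (le_trans _ lo)// lee_fin powR_ge0.
exists (fine (\int[mu]_y (\1_U y * y `^ p)%:E)%E); last by rewrite fineK.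
by rewrite -lte_fin fineK// (lt_le_trans _ lo)// lte_fin powR_gt0.
Qed.

(** A countable exhaustion by compact windows, used for sigma-finiteness and to find a window of
    nonzero mass. *)
Lemma positive_window (x : R) : 0 < x ->
  exists n : nat, (`[n.+1%:R^-1, n%:R]%classic : set R) x.
Proof.
move=> x0; exists (Num.bound x + Num.bound x^-1)%N; rewrite /= in_itv/=.
apply/andP; split.
  rewrite invf_ple ?posrE// (le_trans (ltW (archi_boundP _)))//.
    by rewrite invr_ge0 ltW.
  by rewrite ler_nat -addSn leq_addl.
by rewrite (le_trans (ltW (archi_boundP (ltW x0))))// ler_nat leq_addr.
Qed.

(** The model is x^(s - 1) dx on the half-line, for which the substitution u = y x produces the
    factor y^(- s). *)
Variables (M : {measure set TR -> \bar R}) (s : R).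
Hypothesis M_fin : forall a b : R, 0 < a -> (M `[a, b]%classic < +oo)%E.
Hypothesis M_dil : forall (y : R) (B : set TR), 0 < y -> measurable B ->
  M ((fun x => y * x) @^-1` B) = ((y `^ (- s))%:E * M B)%E.
Hypothesis M0 : M `]-oo, 0]%classic = 0%E.

(** Tonelli requires this. The null half-line is joined to every window so that the sets cover the
    whole line. *)
Lemma homogeneous_sigma_finite : sigma_finite setT M.
Proof.
pose I n : set TR := `[n.+1%:R^-1, n%:R]%classic.
exists (fun n => `]-oo, 0%R]%classic `|` I n).
  apply/seteqP; split => // x _.
  have [x0|x0] := leP x 0; first by exists 0%N => //; left; rewrite /= in_itv/=.
  by have [n nx] := positive_window x0; exists n => //; right.
move=> n; split; first by apply: measurableU; exact: measurable_itv.
apply: (@le_lt_trans _ _ (M `]-oo, 0%R]%classic + M (I n))%E).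
  by apply: measureU2 => //; exact: measurable_itv.
by rewrite M0 add0e; exact: M_fin.
Qed.

Lemma ge0_integral_dilation (y : R) (F : R -> \bar R) : 0 < y ->
  measurable_fun [set: R] F -> (forall x, 0 <= F x)%E ->
  (\int[M]_x F (y * x)%R = (y `^ (- s))%:E * \int[M]_x F x)%E.
Proof.
move=> y0 mF F0.
have mf : measurable_fun [set: TR] (fun x : TR => y * x : TR).
  exact: mulrl_measurable.
have k0 : 0 <= y `^ (- s) by exact: powR_ge0.
rewrite (_ : ((y `^ (- s))%:E)%E = ((NngNum k0)%:num)%:E%E)//
  -ge0_integral_mscale//.
rewrite -[LHS](@ge0_integral_image _ _ TR TR R M _ mf F)//.
apply: eq_measure_integral => A mA _ /=.
by rewrite /mscale/= /pushforward M_dil.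
Qed.

Let U : set TR := `[1, 2]%classic.
(* Pairs (x, z) with x > 0 and z / x in U, written without division. *)
Let E : set (TR * TR) := [set p | 0 < p.1 /\ p.1 <= p.2 <= 2 * p.1].

Let mU : measurable U. Proof. exact: measurable_itv. Qed.

Let mE : measurable E.
Proof.
have -> : E = ((fun p : TR * TR => 0 < p.1) @^-1` [set true]) `&`
    ((fun p : TR * TR => p.1 <= p.2) @^-1` [set true]) `&`
    ((fun p : TR * TR => p.2 <= 2 * p.1) @^-1` [set true]).
  by apply/seteqP; split => p; rewrite /E /=;
    [move=> [-> /andP[-> ->]]|move=> [[-> ->] ->]].
apply: measurableI; first apply: measurableI; rewrite -[X in measurable X]setTI.
- by apply: (@measurable_fun_ltr _ _ _ _ (cst 0) fst).
- by apply: (@measurable_fun_ler _ _ _ _ fst snd).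
- have m2 : measurable_fun [set: TR * TR] (fun p : TR * TR => 2 * p.1 : R).
    by apply: measurable_funM.
  by apply: (@measurable_fun_ler _ _ R setT snd _ _ m2).
Qed.

(* Uniqueness of the Haar measure: Tonelli applied to F (x y) 1_[1,2](y)
   dM(x) dy/y, integrating first over x (dilation by y) or first over y
   (where z = x y). *)
Theorem ge0_integral_homogeneous : exists c : R,
  forall F : R -> \bar R, measurable_fun [set: R] F -> (forall x, 0 <= F x)%E ->
    (\int[M]_x F x =
     c%:E * \int[mu]_(x in `]0%R, +oo[) (F x * (x `^ (s - 1))%:E))%E.
Proof.
(* The exponent collects -1 from dy/y and - s from the dilation by y. *)
have [a a0 aE] := integral_window_powR (- 1 - s).
(* [1/2, 1] is the range of x when x y = 1 and y runs over [1, 2]; for x y = z the range is its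
   dilate [z / 2, z]. *)
pose m0 : R := fine (M `[2^-1, 1]%classic).
have m0E : (m0%:E = M `[2^-1%R, 1%R]%classic)%E.
  by rewrite fineK// ge0_fin_numE// M_fin.
exists (m0 / a) => F' mF' F'0.
(* [F'] may be nonzero on the nonpositive reals, where the substitution z = x y reverses or
   degenerates; [M] does not see the truncation. *)
pose F := (F' \_ `]0%R, +oo[%classic)%E.
have F0 x : (0 <= F x)%E by rewrite /F patchE; case: ifP.
have Fneg x : x <= 0 -> F x = 0%E.
  by move=> x0; rewrite /F patchE ifF//; apply/negP;
    rewrite inE/= in_itv/= andbT ltNge x0.
have mF : measurable_fun [set: R] F.
  by apply/(measurable_restrictT _ _).1 => //; exact: measurable_funTS.
have -> : (\int[M]_x F' x = \int[M]_x F x)%E.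
  rewrite (@ge0_negligible_integral _ TR R M setT _ F' _ measurableT mF' _ M0)//.
  rewrite [RHS](_ : _ = \int[M]_(x in `]0%R, +oo[) F' x)%E; last first.
    by rewrite [RHS]integral_mkcond.
  congr (integral _ _ _); apply/seteqP; split => x /=;
    rewrite !in_itv/= andbT ltNge.
    by move=> [_ /negP].
  by move=> /negP.
pose M' : {sigma_finite_measure set TR -> \bar R} :=
  HB.pack_for (SigmaFiniteMeasure.type TR R) (Measure.sort M)
    (@isSFinite.Build _ _ _ M
       (sfinite_measure_sigma_finite homogeneous_sigma_finite))
    (@isSigmaFinite.Build _ _ _ M homogeneous_sigma_finite).
pose K (p : TR * TR) : \bar R :=
  (F (p.1 * p.2)%R * (\1_U p.2 * p.2 `^ (- 1))%:E)%E.
(* [H] is [K] after z = x y with x fixed: dy/y becomes dz/z, and y in [U] becomes (x, z) in [E]. *)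
pose H (p : TR * TR) : \bar R := (F p.2 * (\1_E p * p.2 `^ (- 1))%:E)%E.
have mK : measurable_fun setT K.
  apply: emeasurable_funM.
    by apply: (measurableT_comp mF); exact: measurable_funM.
  apply/measurable_EFinP; apply: measurable_funM.
    by apply: (@measurableT_comp _ _ _ _ _ _ (\1_U : TR -> R) _ snd) => //;
      exact: measurable_indic.
  apply: (@measurableT_comp _ _ _ _ _ _ (fun y : TR => (y : R) `^ (- 1)) _ snd).
    exact: measurable_powR.
  by [].
have mH : measurable_fun setT H.
  apply: emeasurable_funM.
    by apply: (measurableT_comp mF).
  apply/measurable_EFinP; apply: measurable_funM.
    exact: measurable_indic.
  apply: (@measurableT_comp _ _ _ _ _ _ (fun y : TR => (y : R) `^ (- 1)) _ snd).
    exact: measurable_powR.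
  by [].
have K0 p : (0 <= K p)%E by rewrite mule_ge0// lee_fin mulr_ge0// powR_ge0.
have H0 p : (0 <= H p)%E by rewrite mule_ge0// lee_fin mulr_ge0// powR_ge0.
have I0 : (0 <= \int[M]_x F x)%E by exact: integral_ge0.
have step1 : (\int[mu]_y \int[M']_x K (x, y) = (\int[M]_x F x) * a%:E)%E.
  transitivity (\int[mu]_y ((\int[M]_x F x) * (\1_U y * y `^ (- 1 - s))%:E))%E.
    apply: eq_integral => y _; rewrite indicE.
    case: (boolP (y \in U)) => [yU|yU]; last first.
      rewrite mul0r mule0; apply: integral0_eq => x _.
      by rewrite /K/= indicE (negbTE yU) mul0r mule0.
    have y0 : 0 < y.
      by move: yU; rewrite inE /U/= in_itv/= => /andP[/(lt_le_trans ltr01)].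
    transitivity (\int[M]_x (F (y * x)%R * (y `^ (- 1))%:E))%E.
      by apply: eq_integral => x _; rewrite /K/= indicE yU mul1r mulrC.
    rewrite ge0_integralZr//; last 2 first.
    - by apply: (measurableT_comp mF); exact: mulrl_measurable.
    - by rewrite lee_fin powR_ge0.
    rewrite ge0_integral_dilation// muleAC muleC -EFinM mul1r addrC.
    by rewrite powRD ?(gt_eqF y0) ?implybT.
  rewrite ge0_integralZl// ?aE//.
    apply/measurable_EFinP; apply: measurable_funM;
      first exact: measurable_indic.
    exact: measurable_powR.
  by move=> y _; rewrite lee_fin mulr_ge0// powR_ge0.
have mHx x : measurable_fun setT (fun z : TR => H (x, z)).
  by apply: (measurableT_comp mH); exact: measurable_fun_pair.
have step2 x : (\int[mu]_y K (x, y) = \int[mu]_z H (x, z))%E.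
  have [x0|x0] := leP x 0.
    rewrite !integral0_eq// => y _.
      rewrite /H/= indicE [_ \in _](_ : _ = false) ?mul0r ?mule0//.
      by apply/negP; rewrite inE /E/= => -[]; rewrite ltNge x0.
    rewrite /K/= indicE; case: (boolP (y \in U)) => [|_];
      last by rewrite mul0r mule0.
    rewrite inE /U/= in_itv/= => /andP[y1 _].
    by rewrite Fneg ?mul0e// mulr_le0_ge0// (le_trans _ y1).
  transitivity (\int[mu]_y (x%:E * H (x, (x * y + 0)%R)))%E.
    apply: eq_integral => y _; rewrite addr0 /K /H/= muleCA -EFinM mulrCA.
    rewrite !indicE; have -> : ((x, x * y) \in E) = (y \in U).
      apply/idP/idP; rewrite !inE /E /U/= in_itv/= x0.
        by move=> [_]; rewrite ler_pMr// [x * y]mulrC ler_pM2r// => ->.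
      by move=> y12; split => //; rewrite ler_pMr// [x * y]mulrC ler_pM2r.
    case: (boolP (y \in U)) => [|_]; last by rewrite !mul0r.
    rewrite inE /U/= in_itv/= => /andP[y1 _];
      have y0 : 0 < y by exact: lt_le_trans y1.
    by rewrite !mul1r !powR_inv1 ?ltW ?mulr_gt0// invfM mulrA mulfV ?gt_eqF//
      mul1r.
  rewrite ge0_integralZl//; last 2 first.
  - apply: (measurableT_comp (mHx x)); exact: (@measurable_affine R).
  - by rewrite lee_fin ltW.
  rewrite (@ge0_integral_affine _ x 0 (fun z => H (x, z))) ?gt_eqF//.
  by rewrite muleA -EFinM gtr0_norm// mulfV ?gt_eqF// mul1e.
(* For fixed z > 0 the inner integral is F z / z times the mass of [z / 2, z], which is z^s [m0];
   this produces the density z^(s - 1). *)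
have step3 : (\int[mu]_z \int[M']_x H (x, z) =
    m0%:E * \int[mu]_(z in `]0%R, +oo[) (F' z * (z `^ (s - 1))%:E))%E.
  rewrite -ge0_integralZl//; last 3 first.
  - apply: measurable_funTS; apply: emeasurable_funM => //.
    by apply/measurable_EFinP; exact: measurable_powR.
  - by move=> z _; rewrite mule_ge0// lee_fin powR_ge0.
  - by rewrite m0E.
  rewrite [RHS]integral_mkcond; apply: eq_integral => z _; rewrite patchE.
  case: ifPn => [|]; rewrite ?notin_setE ?inE/= in_itv/= andbT => z0;
    last first.
    apply: integral0_eq => x _; rewrite /H/= Fneg ?mul0e// leNgt; exact/negP.
  transitivity (\int[M]_x
      ((F z * (z `^ (- 1))%:E) * (\1_(`[z / 2, z]%classic : set TR) x)%:E))%E.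
    apply: eq_integral => x _; rewrite /H/= EFinM muleAC muleA;
      congr (_ * _%:E * _)%E.
    rewrite !indicE; congr (_%:R); congr nat_of_bool; apply/idP/idP;
      rewrite !inE /E/= in_itv/=.
      by move=> [x0 /andP[-> zx]]; rewrite andbT ler_pdivrMr// mulrC.
    move=> /andP[zx ->]; rewrite mulrC -ler_pdivrMr//; split => //.
    by rewrite (lt_le_trans _ zx)// divr_gt0.
  rewrite ge0_integralZl//; last 2 first.
  - by apply/measurable_EFinP; apply: measurable_indic; exact: measurable_itv.
  - by rewrite mule_ge0// lee_fin powR_ge0.
  rewrite integral_indic ?setIT//.
  have -> : `[z / 2, z]%classic =
      (fun x : TR => z^-1 * x) @^-1` `[2^-1, 1]%classic.
    apply/seteqP; split => x /=; rewrite !in_itv/= (mulrC z^-1) ler_pdivlMr//;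
    by rewrite (ler_pdivrMr _ _ z0) mul1r (mulrC z).
  rewrite M_dil ?invr_gt0//.
  rewrite -m0E /F patchE ifT ?inE/= ?in_itv/= ?z0// muleA muleC;
    congr (_ * _)%E.
  rewrite -muleA -EFinM -[in z^-1](powR_inv1 (ltW z0)) -powRrM mulrNN mul1r.
  by rewrite addrC powRD ?(gt_eqF z0) ?implybT// mulrC.
have := fubini_tonelli K mK K0 (m1 := M') (m2 := mu).
rewrite step1; under eq_integral do rewrite step2.
rewrite (fubini_tonelli H mH H0) step3 => eqI.
by rewrite mulrC EFinM -muleA eqI muleCA -EFinM mulVf ?gt_eqF// mule1.
Qed.

End homogeneous_measure.

(** * The gamma integral *)

Section gamma_integral.
Context {R : realType}.
Local Notation mu := (@lebesgue_measure R).
Local Notation TR := (measurableTypeR R).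

Lemma powR_expR (t p : R) : expR t `^ p = expR (p * t).
Proof. by rewrite mulrC expRM. Qed.

Lemma integral_inv_1e : (\int[mu]_(x in `[1%R, expR 1]) (x^-1)%:E = 1)%E.
Proof.
have e1 : 1 < expR 1 :> R by rewrite expR_gt1.
have pos (x : R) : 1 <= x -> 0 < x by exact: lt_le_trans.
rewrite (@continuous_FTC2 _ _ (@ln R))//.
- by rewrite expRK ln1 sube0.
- apply: continuous_in_subspaceT => x;
    rewrite inE/= in_itv/= => /andP[/pos x0 _].
  by apply: continuousV; [rewrite gt_eqF|exact: cvg_id].
- split.
  + move=> x; rewrite in_itv/= => /andP[/ltW/pos x0 _].
    by have [] := is_derive1_ln x0.
  + by apply: cvg_at_right_filter; exact: continuous_ln.
  + by apply: cvg_at_left_filter; apply: continuous_ln; rewrite expR_gt0.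
- move=> x; rewrite in_itv/= => /andP[/ltW/pos x0 _].
  by rewrite derive1E; have [_ ->] := is_derive1_ln x0.
Qed.

(* The image of Lebesgue measure under exp is dilation invariant, hence a
   multiple of dx/x; both measures give mass 1 to [1, e]. *)
Lemma ge0_integral_expR (F : R -> \bar R) :
  measurable_fun [set: R] F -> (forall x, 0 <= F x)%E ->
  (\int[mu]_t F (expR t) = \int[mu]_(x in `]0%R, +oo[) (F x * (x^-1)%:E))%E.
Proof.
have me : measurable_fun [set: TR] (fun t : TR => expR t : TR).
  exact: measurable_expR.
have mpre (B : set TR) : measurable B -> measurable ((expR : TR -> TR) @^-1` B).
  by move=> mB; rewrite -[X in measurable X]setTI; exact: me.
pose M := image_measure mu me.
have ME (a b : R) : 0 < a -> (expR : TR -> TR) @^-1` `[a, b] `<=` `[ln a, ln b].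
  move=> a0 t; rewrite /= !in_itv/= => /andP[at_ tb].
  have b0 : 0 < b by rewrite (lt_le_trans _ tb)// expR_gt0.
  by rewrite -(expRK t) !ler_ln ?posrE ?expR_gt0// at_.
have Mfin (a b : R) : 0 < a -> (M `[a, b]%classic < +oo)%E.
  move=> a0; apply: (@le_lt_trans _ _ (mu `[ln a, ln b]%classic)).
    rewrite image_measureE; apply: le_measure; rewrite ?inE//; last exact: ME.
    exact: mpre.
  by rewrite lebesgue_measure_itv/=; case: ifP => _;
    rewrite ?ltry// -EFinB ltry.
have Mdil (y : R) (B : set TR) : 0 < y -> measurable B ->
    M ((fun x => y * x) @^-1` B) = ((y `^ (- 0))%:E * M B)%E.
  move=> y0 mB; rewrite oppr0 powRr0 mul1e !image_measureE.
  rewrite -[RHS]mul1e -[in RHS](@invr1 R) -[in RHS](@normr1 R).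
  rewrite -(@lebesgue_measure_affine _ 1 (ln y))//; last first.
    exact: mpre.
  by congr (mu _); apply/seteqP; split => t /=;
    rewrite mul1r expRD lnK ?posrE// mulrC.
have M0 : M `]-oo, 0]%classic = 0%E.
  rewrite image_measureE (_ : _ @^-1` _ = set0) ?measure0//.
  by apply/seteqP; split => t //=; rewrite in_itv/= leNgt expR_gt0.
have [c cP] := ge0_integral_homogeneous Mfin Mdil M0.
suff c1 : c = 1.
  move=> mF F0; rewrite -(@ge0_integral_image _ _ TR TR R mu _ me F)//.
  rewrite cP// c1 mul1e.
  apply: eq_integral => x; rewrite inE/= in_itv/= andbT sub0r => x0.
  by rewrite powR_inv1// ltW.
pose I : set TR := `[1, expR 1]%classic.
have mI : measurable_fun [set: R] (fun x => (\1_I x)%:E : \bar R).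
  by apply/measurable_EFinP; apply: measurable_indic; exact: measurable_itv.
have I0 x : (0 <= (\1_I x)%:E :> \bar R)%E by rewrite lee_fin.
have mIs : measurable I by rewrite /I; exact: measurable_itv.
have := cP _ mI I0; rewrite (integral_indic M measurableT mIs) setIT.
have -> : M I = 1%E.
  have -> : M I = mu `[0%R, 1%R]%classic.
    rewrite image_measureE; congr (mu _); apply/seteqP.
    have h t : (1 <= expR t :> R) = (0 <= t) by rewrite -[leLHS]expR0 ler_expR.
    by split => t; rewrite /I /= !in_itv/= h ler_expR.
  by rewrite lebesgue_measure_itv/= lte_fin ltr01 sube0.
have -> : (\int[mu]_(x in `]0%R, +oo[) ((\1_I x)%:E * (x `^ (0 - 1))%:E) = 1)%E.
  rewrite -integral_inv_1e [LHS]integral_mkcond [RHS]integral_mkcond.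
  apply: eq_integral => x _; rewrite !patchE indicE.
  rewrite /I !mem_setE !in_itv/= andbT.
  case: ifPn => [x0|]; last first.
    by rewrite -leNgt => x0; rewrite ifF//; apply/negbTE;
      rewrite leNgt (le_lt_trans x0)// andbF.
  rewrite sub0r (powR_inv1 (ltW x0)).
  by case: (1 <= x <= expR 1); rewrite ?mul1e ?mul0e.
by rewrite mule1 => -[].
Qed.

(** In the coordinate t = ln x the map x -> phi x^lam is the affine map t -> lam t + ln phi. *)
Lemma ge0_integral_powR (lam phi : R) (F : R -> \bar R) : lam != 0 -> 0 < phi ->
  measurable_fun [set: R] F -> (forall x, 0 <= F x)%E ->
  (\int[mu]_(x in `]0%R, +oo[) (F (phi * x `^ lam)%R * (x^-1)%:E) =
   `|lam|^-1%:E * \int[mu]_(x in `]0%R, +oo[) (F x * (x^-1)%:E))%E.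
Proof.
move=> lam0 phi0 mF F0.
have mG : measurable_fun [set: R] (fun x => F (phi * x `^ lam)).
  by apply: (measurableT_comp mF); apply: measurable_funM => //;
    exact: measurable_powR.
rewrite -(ge0_integral_expR mG)// -ge0_integral_expR//.
have mFe : measurable_fun [set: R] (fun t => F (expR t)).
  by apply: (measurableT_comp mF); exact: measurable_expR.
rewrite -(@ge0_integral_affine _ _ (ln phi) (fun t => F (expR t)))//.
by apply: eq_integral => t _; rewrite powR_expR expRD lnK ?posrE// mulrC.
Qed.

Definition weight (lam phi a x : R) : R :=
  expR (- (phi * x `^ lam)) * x `^ (a - 1).

Lemma measurable_weight lam phi a : measurable_fun [set: R] (weight lam phi a).
Proof.
apply: measurable_funM; last exact: measurable_powR.
apply: measurableT_comp; first exact: measurable_expR.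
apply: measurable_funN; apply: measurable_funM => //; exact: measurable_powR.
Qed.

Lemma weight_ge0 lam phi a x : 0 <= weight lam phi a x.
Proof. by rewrite mulr_ge0 ?expR_ge0 ?powR_ge0. Qed.

(* The weight with respect to dx/x instead of dx. *)
Let core lam phi a (x : R) : \bar R := (expR (- (phi * x `^ lam)) * x `^ a)%:E.

Let measurable_core lam phi a : measurable_fun [set: R] (core lam phi a).
Proof.
apply/measurable_EFinP; apply: measurable_funM; last exact: measurable_powR.
apply: measurableT_comp; first exact: measurable_expR.
apply: measurable_funN; apply: measurable_funM => //; exact: measurable_powR.
Qed.

Let core_ge0 lam phi a x : (0 <= core lam phi a x)%E.
Proof. by rewrite lee_fin mulr_ge0 ?expR_ge0 ?powR_ge0. Qed.

Let weightE lam phi a x : 0 < x ->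
  (weight lam phi a x)%:E = (core lam phi a x * (x^-1)%:E)%E.
Proof.
move=> x0; rewrite -EFinM /weight -mulrA; congr (_ * _)%:E.
by rewrite powRD ?(gt_eqF x0) ?implybT// powR_inv1// ltW.
Qed.

Lemma integral_weight_expR lam phi a :
  (\int[mu]_(x in `]0%R, +oo[) (weight lam phi a x)%:E =
   \int[mu]_t (expR (a * t - phi * expR (lam * t)))%:E)%E.
Proof.
transitivity (\int[mu]_(x in `]0%R, +oo[) (core lam phi a x * (x^-1)%:E))%E.
  by apply: eq_integral => x; rewrite inE/= in_itv/= andbT; exact: weightE.
rewrite -ge0_integral_expR//; apply: eq_integral => t _.
by rewrite /core !powR_expR -expRD addrC.
Qed.

(** Substituting u = phi x^lam turns x^(k lam) dx/x into |lam|^(-1) phi^(- k) u^k du/u. *)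
Lemma integral_weight (lam phi k : R) : lam != 0 -> 0 < phi ->
  (\int[mu]_(x in `]0%R, +oo[) (weight lam phi (k * lam) x)%:E =
   (`|lam|^-1 * phi `^ (- k))%:E *
   \int[mu]_(t in `]0%R, +oo[) (t `^ (k - 1) * expR (- t))%:E)%E.
Proof.
move=> lam0 phi0.
have k0 : 0 <= phi `^ (- k) by exact: powR_ge0.
have -> : (\int[mu]_(t in `]0%R, +oo[) (t `^ (k - 1) * expR (- t))%:E =
    \int[mu]_(x in `]0%R, +oo[) (core 1 1 k x * (x^-1)%:E))%E.
  apply: eq_integral => x; rewrite inE/= in_itv/= andbT => x0.
  by rewrite -weightE// /weight mul1r powRr1 1?mulrC// ltW.
have mG : measurable_fun (`]0%R, +oo[%classic : set TR)
    (fun x : TR => core 1 1 k (phi * x `^ lam) * (x^-1)%:E)%E.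
  apply: emeasurable_funM.
    apply: measurable_funTS; apply: (measurableT_comp (@measurable_core 1 1 k)).
    by apply: measurable_funM => //; exact: measurable_powR.
  apply: (@eq_measurable_fun _ _ TR _ _ (fun x : TR => (x `^ (- 1))%:E));
    last first.
    by apply: measurable_funTS; apply/measurable_EFinP; exact: measurable_powR.
  by move=> x; rewrite inE/= in_itv/= andbT => x0; rewrite powR_inv1// ltW.
rewrite [`|lam|^-1 * _]mulrC EFinM -muleA.
rewrite -(@ge0_integral_powR lam phi (core 1 1 k))//.
rewrite -(ge0_integralZl_EFin _ _ _ mG)//; last first.
- move=> x; rewrite /= in_itv/= andbT => x0.
  by rewrite mule_ge0// lee_fin invr_ge0 ltW.
apply: eq_integral => x; rewrite inE/= in_itv/= andbT => x0.
rewrite weightE// muleA; congr (_ * _)%E.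
rewrite /core mul1r powRr1 ?mulr_ge0 ?powR_ge0 ?(ltW phi0)// -EFinM mulrCA;
  congr (_ * _)%:E.
rewrite powRM ?powR_ge0 ?(ltW phi0)// mulrA -powRD ?(gt_eqF phi0) ?implybT//.
by rewrite addNr powRr0 mul1r -powRrM mulrC.
Qed.

Lemma integral_weight_fin (lam phi a : R) :
  (\int[mu]_(x in `]0%R, +oo[) (weight lam phi a x)%:E < +oo)%E ->
  [/\ lam != 0, 0 < phi & 0 < a / lam].
Proof.
rewrite integral_weight_expR.
set f := fun t => _; set I := integral _ _ _ => Ioo.
have mf : measurable_fun [set: R] f.
  rewrite /f; apply/measurable_EFinP/measurableT_comp;
    first exact: measurable_expR.
  apply: measurable_funB; first by apply: measurable_funM.
  apply: measurable_funM => //; apply: measurableT_comp;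
    first exact: measurable_expR.
  by apply: measurable_funM.
(* the integrand is bounded below by a positive constant on a half-line *)
have key (A : set TR) (d : R) : measurable A -> mu A = +oo%E -> 0 < d ->
    (forall t, A t -> d%:E <= f t)%E -> False.
  move=> mA muA d0 dA.
  have : (d%:E * mu A <= I)%E.
    rewrite -integral_cst//; apply: (@le_trans _ _ (\int[mu]_(t in A) f t)%E).
      by apply: ge0_le_integral => //; 
        [move=> t _; rewrite lee_fin ltW|exact: measurable_funTS].
    by apply: ge0_subset_integral => // t _; rewrite /f lee_fin expR_ge0.
  by rewrite muA gt0_muley ?lte_fin// leye_eq => /eqP I1; rewrite I1 in Ioo.
have halfline (b : R) : exists A : set TR,
    [/\ measurable A, mu A = +oo%E & forall t, A t -> 0 <= b * t].
  have [b0|b0] := leP 0 b.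
    exists `[0%R, +oo[%classic; split; first exact: measurable_itv.
      by rewrite lebesgue_measure_itv/= ltry.
    by move=> t; rewrite /= in_itv/= andbT; exact: mulr_ge0.
  exists `]-oo, 0%R]%classic; split; first exact: measurable_itv.
    by rewrite lebesgue_measure_itv/= ltNyr.
  by move=> t; rewrite /= in_itv/= => t0; rewrite mulr_le0// ltW.
have lam0 : lam != 0.
  apply/eqP => lam0; have [A [mA muA At]] := halfline a.
  apply: (key A (expR (- phi))) => //; first exact: expR_gt0.
  move=> t /At at0; rewrite /f lee_fin ler_expR lam0 mul0r expR0 mulr1.
  by rewrite lerBrDr addNr.
have phi0 : 0 < phi.
  rewrite ltNge; apply/negP => phi0; have [A [mA muA At]] := halfline a.
  apply: (key A 1) => // t /At at0.
  rewrite /f lee_fin -[leLHS]expR0 ler_expR subr_ge0 (le_trans _ at0)//.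
  by rewrite mulr_le0_ge0// expR_ge0.
split => //; rewrite ltNge; apply/negP => alam.
(* Where lam t <= 0, the term phi e^(lam t) is at most phi, and a t = (a / lam) (lam t) is a product
   of two nonpositive factors. *)
have [A [mA muA At]] := halfline (- lam).
apply: (key A (expR (- phi))) => //; first exact: expR_gt0.
move=> t /At; rewrite mulNr oppr_ge0 => lt0.
rewrite /f lee_fin ler_expR -[leLHS]add0r lerD//.
  have -> : a * t = a / lam * (lam * t) by rewrite mulrA divfK.
  exact: mulr_le0.
by rewrite lerN2; apply: ler_piMr; [exact: ltW|rewrite -[leRHS]expR0 ler_expR].
Qed.

Let Gamma_integral_expR (k : R) :
  (\int[mu]_(t in `]0%R, +oo[) (t `^ (k - 1) * expR (- t))%:E =
   \int[mu]_t (expR (k * t - expR t))%:E)%E.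
Proof.
transitivity (\int[mu]_(x in `]0%R, +oo[) (weight 1 1 k x)%:E)%E.
  apply: eq_integral => x; rewrite inE/= in_itv/= andbT => x0.
  by rewrite /weight mul1r powRr1 1?mulrC// ltW.
by rewrite integral_weight_expR; apply: eq_integral => t _; rewrite !mul1r.
Qed.

Let measurable_gumbel (k : R) :
  measurable_fun [set: TR] (fun t : TR => (expR (k * t - expR t))%:E : \bar R).
Proof.
apply/measurable_EFinP/measurableT_comp; first exact: measurable_expR.
by apply: measurable_funB; [exact: measurable_funM|exact: measurable_expR].
Qed.

(** In the coordinate t the integrand e^(k t - e^t) is at most e^(C - t) for t >= 0 and at most e^(k
    t) for t < 0. These are multiples of an exponential density of rate 1 and of a reflected one of
    rate k, each of total mass 1. *)
Lemma Gamma_integral_fin (k : R) : 0 < k ->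
  (\int[mu]_(t in `]0%R, +oo[) (t `^ (k - 1) * expR (- t))%:E < +oo)%E.
Proof.
move=> k0; rewrite Gamma_integral_expR.
(* At [ln (k + 1)] the exponential has slope k + 1, so subtracting its tangent from k t leaves slope
   -1 and the constant term [C]. *)
pose C := (k + 1) * (ln (k + 1) - 1).
have k10 : 0 < k + 1 by exact: addr_gt0.
(* tangent line of the exponential at ln (k + 1) *)
have tangent t : k * t - expR t <= C - t.
  have -> : expR t = (k + 1) * expR (t - ln (k + 1)).
    by rewrite expRB lnK ?posrE// mulrCA mulfV ?gt_eqF// mulr1.
  have := expR_ge1Dx (t - ln (k + 1)); rewrite -(ler_pM2l k10) /C; lra.
have mp r : measurable_fun [set: TR]
    (fun t : TR => (exponential_pdf r t)%:E : \bar R).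
  by apply/measurable_EFinP; exact: measurable_exponential_pdf.
have p0 (r x : R) : 0 < r -> 0 <= exponential_pdf r x.
  by move=> r0; rewrite exponential_pdf_ge0// ltW.
have mpk : measurable_fun [set: TR]
    (fun t : TR => (exponential_pdf k (-1 * t + 0)%R)%:E : \bar R).
  apply: (measurableT_comp (mp k)); exact: (@measurable_affine R).
have eC0 : 0 <= expR C by exact: expR_ge0.
have ik0 : 0 <= k^-1 by rewrite invr_ge0 ltW.
have m1 : measurable_fun [set: TR]
    (fun t : TR => (expR C)%:E * (exponential_pdf 1 t)%:E)%E.
  exact: measurable_funeM.
have m2 : measurable_fun [set: TR]
    (fun t : TR => (k^-1)%:E * (exponential_pdf k (-1 * t + 0)%R)%:E)%E.
  exact: measurable_funeM.
apply: (@le_lt_trans _ _ (\int[mu]_t ((expR C)%:E * (exponential_pdf 1 t)%:E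
    + (k^-1)%:E * (exponential_pdf k (-1 * t + 0)%R)%:E)))%E.
  apply: ge0_le_integral => //.
  - exact: emeasurable_funD.
  - move=> t _; rewrite -!EFinM -EFinD lee_fin mulN1r addr0.
    have [t0|t0] := leP 0 t.
      rewrite -[leLHS]addr0 lerD ?mulr_ge0 ?p0//.
      by rewrite exponential_pdfE// mul1r mulN1r -expRD ler_expR.
    rewrite -[leLHS]add0r lerD ?mulr_ge0 ?p0//.
    rewrite exponential_pdfE; last by rewrite oppr_ge0 ltW.
    by rewrite mulrA mulVf ?(gt_eqF k0)// mul1r mulrNN ler_expR gerBl expR_ge0.
rewrite ge0_integralD//; last 2 first.
- by move=> t _; rewrite -EFinM lee_fin mulr_ge0// p0.
- by move=> t _; rewrite -EFinM lee_fin mulr_ge0// p0.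
rewrite !ge0_integralZl_EFin//; last 2 first.
- by move=> t _; rewrite lee_fin p0.
- by move=> t _; rewrite lee_fin p0.
rewrite (@ge0_integral_affine _ (-1) 0 (fun t => (exponential_pdf k t)%:E))
  ?oppr_eq0 ?oner_eq0//; last first.
  by move=> t; rewrite lee_fin p0.
by rewrite !integral_exponential_pdf// !mule1 -!EFinM -EFinD ltry.
Qed.

(** [Gamma] takes the finite part of the integral, so the equality rests on finiteness. *)
Lemma Gamma_integralE (k : R) : 0 < k ->
  (\int[mu]_(t in `]0%R, +oo[) (t `^ (k - 1) * expR (- t))%:E = (Gamma k)%:E)%E.
Proof.
move=> k0; rewrite /Gamma /Rintegral fineK// ge0_fin_numE ?Gamma_integral_fin//.
by apply: integral_ge0 => t _; rewrite lee_fin mulr_ge0// ?powR_ge0 ?expR_ge0.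
Qed.

(** For 0 <= t <= 1 the integrand e^(k t - e^t) is at least e^(- e). *)
Lemma Gamma_gt0 (k : R) : 0 < k -> 0 < Gamma k.
Proof.
move=> k0; rewrite -lte_fin -Gamma_integralE// Gamma_integral_expR.
have I1 : mu `[0%R, 1%R]%classic = 1%E.
  by rewrite lebesgue_measure_itv/= lte_fin ltr01 sube0.
apply: (@lt_le_trans _ _ ((expR (- expR 1))%:E * mu `[0%R, 1%R]%classic)%E).
  by rewrite I1 mule1 lte_fin expR_gt0.
rewrite -integral_cst//.
apply: (@le_trans _ _
  (\int[mu]_(t in `[0%R, 1%R]) (expR (k * t - expR t))%:E)%E).
  apply: ge0_le_integral => //.
  - by move=> t _; rewrite lee_fin expR_ge0.
  - by apply: measurable_funTS; exact: measurable_gumbel.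
  - move=> t; rewrite /= in_itv/= => /andP[t0 t1].
    by rewrite lee_fin ler_expR -[leLHS]add0r lerD ?lerN2 ?ler_expR//
      mulr_ge0// ltW.
by apply: ge0_subset_integral => // t _; rewrite lee_fin expR_ge0.
Qed.

End gamma_integral.

(** * The quotient of the positive reals by the trivial subgroup *)

Section borel_measurability.

Lemma open_borel (T : ptopologicalType) (U : set T) :
  open U -> measurable (U : set (borel T)).
Proof. by move=> oU; exact: sub_sigma_algebra. Qed.

Lemma continuous_borel (T U : ptopologicalType) (f : T -> U) :
  continuous f -> measurable_fun setT (f : borel T -> borel U).
Proof.
move=> /continuousP cf;
  apply: (@measurability _ _ (borel T) (borel U) setT f (@open U)) => //.
by move=> _ [A oA <-]; rewrite setTI; apply: open_borel; exact: cf.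
Qed.

Lemma continuous_borel_real (R : realType) (T : ptopologicalType) (f : T -> R) :
  continuous f -> measurable_fun setT (f : borel T -> measurableTypeR R).
Proof.
move=> /continuousP cf; apply: (measurability _ (RGenOpens.measurableE R)).
move=> _ [_ [a [b ->] <-]]; rewrite setTI; apply: open_borel; apply: cf.
exact: interval_open.
Qed.

End borel_measurability.

Section positive_reals_quotient.
Context {R : realType}.
Local Notation TR := (measurableTypeR R).
Local Notation G := (posreal R).
Local Notation X := (homogeneous_space (triv R)).

(* Extended by the junk value 1 on the nonpositive reals. *)
Definition posof (x : R) : G :=
  if pselect (0 < x) is left x0 then posmk x0 else pos1 R.

Lemma posofK (x : R) : 0 < x -> posval (posof x) = x.
Proof. by move=> x0; rewrite /posof; case: pselect. Qed.

Lemma posvalK (g : G) : posof (posval g) = g.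
Proof. by apply/val_inj; exact/posofK/posval_gt0. Qed.

Lemma posvalM (g h : G) : posval (g * h)%g = posval g * posval h.
Proof. by []. Qed.

Lemma posof_open (U : set G) : open U ->
  exists2 V : set R, open V & U = @posval R @^-1` V.
Proof. by move=> [V oV <-]; exists V. Qed.

Lemma measurable_posof : measurable_fun setT (posof : TR -> borel G).
Proof.
apply: (@measurability _ _ TR (borel G) setT posof (@open G)) => // _ [U oU <-].
rewrite setTI.
have [V oV ->] := posof_open oU.
(* The nonpositive half-line is sent to the junk value 1, so it lies in the preimage entirely or not
   at all, according to whether V contains 1. *)
have -> : posof @^-1` (@posval R @^-1` V) =
    (`]0, +oo[%classic `&` V) `|` (`]-oo, 0]%classic `&` [set _ | V 1]).
  apply/seteqP; split => x; rewrite /= !in_itv/= andbT /posof;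
    case: pselect => x0 /=.
  - by left.
  - by right; rewrite leNgt; split => //; exact/negP.
  - by move=> [[]//|[]]; rewrite leNgt x0.
  - by move=> [[]//|[]].
apply: measurableU; apply: measurableI; try exact: measurable_itv.
  exact: open_measurable.
have [V1|nV1] := pselect (V 1).
  by rewrite (_ : [set _ | _] = setT)//; apply/seteqP; split.
by rewrite (_ : [set _ | _] = set0)//; apply/seteqP; split.
Qed.

(** Cosets of the trivial subgroup are singletons, so the chosen representative is the element
    itself. *)
Lemma coset_piK (g : G) : repr (coset_pi (triv R) g) = g.
Proof.
have : (coset_pi (triv R) (repr (coset_pi (triv R) g)) = coset_pi (triv R) g).
  by rewrite /coset_pi reprK.
move=> /eqmodP /asboolP /=.
move=> /(congr1 (fun h => repr (coset_pi (triv R) g) * h)%g).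
by rewrite mulgA mulgV mul1g mulg1.
Qed.

Lemma coset_reprK (x : X) : coset_pi (triv R) (repr x) = x.
Proof. exact: reprK. Qed.

Lemma coset_pi_continuous : continuous (coset_pi (triv R) : G -> X).
Proof. exact: pi_continuous. Qed.

(** Openness in the quotient is tested by pulling back along the projection, and the preimage of A
    under [repr] pulls back to A. *)
Lemma coset_repr_continuous : continuous (repr : X -> G).
Proof.
apply/continuousP => A oA; rewrite /open/= /quotient_open.
rewrite (_ : _ @^-1` _ = A)//; apply/seteqP; split => g; rewrite /preimage/=.
  by rewrite coset_piK.
by rewrite coset_piK.
Qed.

Definition coset_val (x : X) : R := posval (repr x).
Definition coset_of_val (x : R) : X := coset_pi (triv R) (posof x).

Lemma coset_val_gt0 x : 0 < coset_val x. Proof. exact: posval_gt0. Qed.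

Lemma coset_valK x : coset_of_val (coset_val x) = x.
Proof. by rewrite /coset_of_val /coset_val posvalK coset_reprK. Qed.

Lemma coset_of_valK x : 0 < x -> coset_val (coset_of_val x) = x.
Proof. by move=> x0; rewrite /coset_val /coset_of_val coset_piK posofK. Qed.

Lemma coset_val_act g x : coset_val (coset_act g x) = posval g * coset_val x.
Proof. by rewrite /coset_val /coset_act coset_piK. Qed.

Lemma coset_val_continuous : continuous coset_val.
Proof.
move=> x; apply: continuous_comp; first exact: coset_repr_continuous.
exact: posval_continuous.
Qed.

Lemma measurable_coset_val : measurable_fun setT (coset_val : borel X -> TR).
Proof. exact: continuous_borel_real coset_val_continuous. Qed.

Lemma measurable_coset_pi :
  measurable_fun setT (coset_pi (triv R) : borel G -> borel X).
Proof. exact: continuous_borel coset_pi_continuous. Qed.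

Lemma measurable_coset_repr : measurable_fun setT (repr : borel X -> borel G).
Proof. exact: continuous_borel coset_repr_continuous. Qed.

Lemma measurable_coset_of_val :
  measurable_fun setT (coset_of_val : TR -> borel X).
Proof. exact: measurableT_comp measurable_coset_pi measurable_posof. Qed.

(** [dx_density] integrates over an image, while measures are pushed forward by preimages; this
    identity links the two. *)
Lemma posval_imageE (A : set G) :
  @posval R @` A = posof @^-1` A `&` `]0, +oo[%classic.
Proof.
apply/seteqP; split => [_ [g Ag <-]|x []] /=; rewrite in_itv/= andbT.
  by rewrite posvalK posval_gt0.
by move=> Ax x0; exists (posof x); rewrite ?posofK.
Qed.

(** A continuous image of the segment [a, b]. Replacing x by max(a, x) gives a map continuous on all
    of R, whereas [posof] jumps at 0. *)
Lemma coset_val_compact (a b : R) : 0 < a -> compact (coset_val @^-1` `[a, b]).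
Proof.
move=> a0.
have a_max x : a <= Num.max a x by rewrite le_max lexx.
pose clamp (x : R) : G := posmk (lt_le_trans a0 (a_max x)).
have cclamp : continuous (coset_pi (triv R) \o clamp : R -> X).
  move=> x; apply: continuous_comp; last exact: coset_pi_continuous.
  apply: posreal_cvg => {}x; rewrite /comp/=.
  apply: (@continuous_max _ _ (cst a) idfun x); [exact: cvg_cst|exact: cvg_id].
have -> : coset_val @^-1` `[a, b] = (coset_pi (triv R) \o clamp) @` `[a, b].
  apply/seteqP; split => [x|_ [x /= xab <-]] /=.
    move=> xab; exists (coset_val x) => //;
      rewrite -[RHS]coset_valK /coset_of_val/=.
    congr coset_pi; apply/val_inj => /=;
      rewrite -/(posval _) posofK ?coset_val_gt0//.
    by apply/max_idPr; move: xab; rewrite in_itv/= => /andP[].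
  rewrite /coset_val coset_piK /posval/=; move: (xab);
    rewrite in_itv/= => /andP[ax xb].
  by rewrite in_itv/= le_max lexx/= ge_max (le_trans ax).
apply: continuous_compact; last exact: segment_compact.
exact: continuous_subspaceT.
Qed.

End positive_reals_quotient.

(** * Relatively invariant Radon measures *)

Section admissible_measures.
Context {R : realType}.
Local Notation mu := (@lebesgue_measure R).
Local Notation TR := (measurableTypeR R).
Local Notation X := (homogeneous_space (triv R)).

(* chi is a homomorphism since some window [a, b] has finite nonzero measure;
   it is bounded on [1, e] by comparison with [a / e, b], hence a power. *)
Lemma admissible_integral (nu : {measure set (borel X) -> \bar R}) :
  admissible nu -> exists c s : R, 0 < c /\
    forall F : R -> \bar R, measurable_fun [set: R] F ->
    (forall x, 0 <= F x)%E ->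
    (\int[nu]_x F (coset_val x) =
     c%:E * \int[mu]_(z in `]0%R, +oo[) (F z * (z `^ (s - 1))%:E))%E.
Proof.
move=> [nuT [nuK _ _] [chi chi0 chiE]].
pose M := image_measure nu (@measurable_coset_val R).
have ME A : M A = nu (coset_val @^-1` A) by [].
pose k (y : R) := (chi (posof y))^-1.
have k0 y : 0 < k y by rewrite invr_gt0.
have Mk (y : R) (B : set TR) : 0 < y -> measurable B ->
    M ((fun x => y * x) @^-1` B) = ((k y)%:E * M B)%E.
  move=> y0 mB; rewrite (ME B) ME -chiE; last first.
    by rewrite -[X in measurable X]setTI; exact: measurable_coset_val.
  rewrite /pushforward; congr (nu _); apply/seteqP.
  by split => x; rewrite /preimage/= coset_val_act posofK.
have M0 : M `]-oo, 0]%classic = 0%E.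
  rewrite ME (_ : _ @^-1` _ = set0) ?measure0//.
  by apply/seteqP; split => t //=; rewrite in_itv/= leNgt coset_val_gt0.
have Mfin (a b : R) : 0 < a -> (M `[a, b]%classic < +oo)%E.
  by move=> a0; rewrite ME; apply: nuK; exact: coset_val_compact.
pose I n : set TR := `[n.+1%:R^-1, n%:R]%classic.
(* Otherwise X would be a countable union of null windows, against [nuT]. *)
have [n In] : exists n, M (I n) != 0%E.
  apply: contrapT => /forallNP I0.
  have : nu.-negligible (\bigcup_n (coset_val @^-1` I n)).
    apply: negligible_bigcup => n; apply/negligibleP.
      by rewrite -[X in measurable X]setTI; apply: measurable_coset_val => //;
        exact: measurable_itv.
    by have /negP/negPn/eqP := I0 n.
  have -> : \bigcup_n (coset_val @^-1` I n) = [set: X].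
    apply/seteqP; split => // x _.
    by have [j jx] := positive_window (coset_val_gt0 x); exists j.
  by move=> /(measure_negligible measurableT)/eqP; rewrite (negbTE nuT).
pose a : R := n.+1%:R^-1; pose b : R := n%:R.
have a0 : 0 < a by rewrite invr_gt0.
have mI : measurable (I n) by rewrite /I; exact: measurable_itv.
pose m := fine (M (I n)).
have mE : (m%:E = M (I n))%E by rewrite fineK// ge0_fin_numE// Mfin.
have m0 : 0 < m by rewrite -lte_fin mE lt_neqAle eq_sym In measure_ge0.
have kM y z : 0 < y -> 0 < z -> k (y * z) = k y * k z.
  move=> y0 z0; apply: (mulIf (lt0r_neq0 m0)); apply: EFin_inj.
  have mz : measurable ((fun x : TR => z * x : TR) @^-1` I n).
    by rewrite -[X in measurable X]setTI; exact: mulrl_measurable.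
  rewrite -mulrA !EFinM !mE -Mk ?mulr_gt0// -Mk// -Mk//.
  congr (M _); apply/seteqP.
  by split => x; rewrite /preimage/= mulrA (mulrC z).
have [C kC] : exists C, forall t, 0 <= t <= 1 -> k (expR t) <= C.
  exists (fine (M `[a / expR 1, b]%classic) / m) => t /andP[t0 t1].
  rewrite ler_pdivlMr// -lee_fin EFinM mE -Mk ?expR_gt0// fineK; last first.
    by rewrite ge0_fin_numE// Mfin// divr_gt0// expR_gt0.
  rewrite le_measure ?inE//.
    by rewrite -[X in measurable X]setTI; exact: mulrl_measurable.
  move=> x; rewrite /preimage/= /I /= !in_itv/= => /andP[ax xb].
  have x0 : 0 < x by rewrite -(pmulr_rgt0 _ (expR_gt0 t)) (lt_le_trans _ ax).
  rewrite ler_pdivrMr ?expR_gt0// (le_trans ax)/=;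
    last by rewrite mulrC ler_pM2l// ler_expR.
  by apply: (le_trans _ xb); apply: ler_peMl;
    [exact: ltW|rewrite -[leLHS]expR0 ler_expR].
have C0 : 0 < C by rewrite (lt_le_trans (k0 (expR 0)))// kC// lexx ler01.
pose l t := ln (k (expR t)).
have lE t : l t = l 1 * t.
  apply: (@additive_bounded_above _ l (ln C)).
    by move=> u v; rewrite /l expRD kM ?expR_gt0// lnM ?posrE.
  by move=> u /kC uC; rewrite /l ler_ln ?posrE.
have kE y : 0 < y -> k y = y `^ (l 1).
  by move=> y0; rewrite -[in RHS](lnK y0) powR_expR -lE /l (lnK y0) lnK ?posrE.
have Mdil (y : R) (B : set TR) : 0 < y -> measurable B ->
    M ((fun x => y * x) @^-1` B) = ((y `^ (- (- l 1)))%:E * M B)%E.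
  by move=> y0 mB; rewrite opprK -kE// Mk.
have [c cP] := ge0_integral_homogeneous Mfin Mdil M0.
exists c, (- l 1); split; last first.
  by move=> F mF F0; rewrite -cP//; apply: esym;
    exact: (@ge0_integral_image _ _ _ TR).
(* Testing with F = 1, a nonpositive c would make the total mass of [nu] vanish. *)
rewrite ltNge; apply/negP => c0.
have mone : measurable_fun [set: R] (cst 1%E : R -> \bar R) by [].
have := cP _ mone (fun=> lee01); rewrite integral_cst// mul1e => MT.
move: nuT; rewrite -[X in nu X](@preimage_setT _ _ coset_val) -ME.
rewrite eq_le measure_ge0 andbT => /negP; apply; rewrite MT.
apply: mule_le0_ge0; rewrite ?lee_fin//.
by apply: integral_ge0 => z _; rewrite mul1e lee_fin powR_ge0.
Qed.

End admissible_measures.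

(** * Lebesgue measure as a relatively invariant Radon measure *)

Section lebesgue_admissible.
Context {R : realType}.
Local Notation mu := (@lebesgue_measure R).
Local Notation TR := (measurableTypeR R).
Local Notation X := (homogeneous_space (triv R)).

Lemma measurable_positives : measurable (`]0%R, +oo[%classic : set TR).
Proof. exact: measurable_itv. Qed.

Let nu : {measure set (borel X) -> \bar R} :=
  image_measure (mrestr mu measurable_positives) (@measurable_coset_of_val R).

Lemma coset_val_imageE (A : set X) :
  coset_val @` A = coset_of_val @^-1` A `&` `]0, +oo[%classic.
Proof.
apply/seteqP; split => [_ [x Ax <-]|x []] /=; rewrite in_itv/= andbT.
  by rewrite coset_valK coset_val_gt0.
by move=> Ax x0; exists (coset_of_val x); rewrite ?coset_of_valK.
Qed.

Lemma measurable_coset_val_image (A : set (borel X)) : measurable A ->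
  measurable (coset_val @` A : set TR).
Proof.
move=> mA; rewrite coset_val_imageE; apply: measurableI;
  last exact: measurable_itv.
by rewrite -[X in measurable X]setTI; exact: measurable_coset_of_val.
Qed.

Let nuE (A : set X) : nu A = mu (coset_val @` A).
Proof. by rewrite coset_val_imageE. Qed.

Let image_preimage_coset_val (V : set R) :
  coset_val @` (coset_val @^-1` V) = V `&` `]0, +oo[%classic.
Proof.
apply/seteqP; split => [_ [x Vx <-]|x []]; rewrite /= in_itv/= andbT.
  by rewrite coset_val_gt0.
by move=> Vx x0; exists (coset_of_val x); rewrite /preimage/= coset_of_valK.
Qed.

Let compact_image (K : set X) : compact K -> compact (coset_val @` K).
Proof.
by apply: continuous_compact; apply: continuous_subspaceT;
  exact: coset_val_continuous.
Qed.

(** The least element a of a nonempty K is positive, so the preimage is a closed subset of the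
    compact preimage of [a, b], with b the greatest element. *)
Let compact_preimage (K : set R) : compact K -> K `<=` `]0, +oo[%classic ->
  compact (coset_val @^-1` K).
Proof.
move=> cK K0; have [->|/set0P Kne] := eqVneq K set0.
  by rewrite preimage_set0; exact: compact0.
have cid : {within K, continuous (id : R ->
  R)} by apply: continuous_subspaceT => x; exact: cvg_id.
have [a /set_mem Ka amin] := compact_EVT_min Kne cK cid.
have [b _ bmax] := compact_EVT_max Kne cK cid.
have a0 : 0 < a by have := K0 _ Ka; rewrite /= in_itv/= andbT.
apply: (subclosed_compact _ (@coset_val_compact R a b a0)).
  apply: preimage_closed; first by move=> x _; exact: coset_val_continuous.
  by apply: compact_closed => //; exact: Rhausdorff.
by move=> x /mem_set Kx; rewrite /preimage/= in_itv/= amin// bmax.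
Qed.

(** Regularity passes from the line to X: an open V around the image of A pulls back to an open set
    around A of mass at most that of V, and compact sets correspond under [coset_val]. *)
Let radon_nu : radon nu.
Proof.
split.
- move=> K cK; rewrite nuE; apply: compact_finite_measure; exact: compact_image.
- move=> A mA; apply/eqP; rewrite eq_le; apply/andP; split.
    apply: le_ereal_inf_tmp => _ [U [oU AU] <-].
    by apply: le_measure; rewrite ?inE//; exact: open_borel.
  have [->|Aoo] := eqVneq (nu A) +oo%E; first by rewrite leey.
  have mB := measurable_coset_val_image mA.
  have Bfin : (mu (coset_val @` A) < +oo)%E by rewrite -nuE ltey.
  apply/lee_addgt0Pr => e e0.
  have [V [oV BV Ve]] := lebesgue_regularity_outer mB Bfin e0.
  have oU : open (coset_val @^-1` V).
    by move/continuousP : (@coset_val_continuous R); exact.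
  apply: (@le_trans _ _ (nu (coset_val @^-1` V))).
    apply: ereal_inf_lbound; exists (coset_val @^-1` V) => //; split => //.
    by move=> x Ax; apply: BV; exists x.
  have mV : measurable (V : set TR) by exact: open_measurable.
  rewrite nuE image_preimage_coset_val nuE.
  apply: (@le_trans _ _ (mu V)); first by apply: measureIl => //;
    exact: measurable_itv.
  rewrite -(setDKU BV);
    apply: (@le_trans _ _ (mu (V `\` coset_val @` A) + mu (coset_val @` A))%E).
    by apply: measureU2 => //; exact: measurableD.
  by rewrite addeC leeD2l// ltW.
- move=> U oU; rewrite nuE lebesgue_regularity_inner_sup; last first.
    by apply: measurable_coset_val_image; exact: open_borel.
  congr ereal_sup; apply/seteqP; split => [_ [K [cK KU] <-]|_ [K [cK KU] <-]].
    have K0 : K `<=` `]0, +oo[%classic.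
      by move=> x /KU; rewrite coset_val_imageE => -[].
    exists (coset_val @^-1` K).
      split; first exact: compact_preimage.
      by move=> x /KU [y Uy /(congr1 coset_of_val)]; rewrite !coset_valK => <-.
    by rewrite nuE image_preimage_coset_val; congr (mu _); apply/setIidPl.
  exists (coset_val @` K); last by rewrite nuE.
  by split; [exact: compact_image|exact: image_subset].
Qed.

(* Lebesgue measure itself is relatively invariant, with chi g = g, and its
   regularity is in the library. *)
Lemma exists_admissible :
  exists nu : {measure set (borel X) -> \bar R}, admissible nu.
Proof.
exists nu; split => //.
  rewrite nuE coset_val_imageE preimage_setT setTI.
  by rewrite lebesgue_measure_itv/= ltry.
exists (@posval R); first exact: posval_gt0.
move=> g A mA; rewrite /pushforward !nuE.
have g0 := posval_gt0 g.
rewrite -[(posval g)^-1]gtr0_norm ?invr_gt0// normfV.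
rewrite -(@lebesgue_measure_affine _ _ 0) ?gt_eqF//;
  last exact: measurable_coset_val_image.
congr (mu _); apply/seteqP; split => [_ [x Agx <-]|z [x Ax xE]].
  by rewrite /preimage/= addr0; exists (coset_act g x) => //;
    rewrite coset_val_act.
have z0 : 0 < z by rewrite -(pmulr_rgt0 _ g0) -[_ * _]addr0 -xE coset_val_gt0.
exists (coset_of_val z); rewrite ?coset_of_valK// /preimage/=.
rewrite -[coset_act _ _]coset_valK coset_val_act coset_of_valK//.
by rewrite -[_ * _]addr0 -xE coset_valK.
Qed.

End lebesgue_admissible.

(** * Representations, characters and densities *)

Section density_measure.
Local Open Scope ereal_scope.
Context d (T : measurableType d) (R : realType) (m : {measure set T -> \bar R}).
Variables (f : T -> \bar R).
Hypotheses (mf : measurable_fun setT f) (f0 : forall x, 0 <= f x).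

Let dens (A : set T) : \bar R := \int[m]_(x in A) f x.

Let dens0 : dens set0 = 0. Proof. exact: integral_set0. Qed.

Let dens_ge0 A : 0 <= dens A. Proof. exact: integral_ge0. Qed.

Let dens_sigma_additive : semi_sigma_additive dens.
Proof.
move=> F mF tF mUF; rewrite /dens ge0_integral_bigcup//;
  last exact: measurable_funTS.
apply: is_cvg_ereal_nneg_natsum_cond => n _ _; exact: integral_ge0.
Qed.

Lemma density_measure : exists D : {measure set T -> \bar R},
  forall A, D A = \int[m]_(x in A) f x.
Proof.
pose D : {measure set T -> \bar R} :=
  HB.pack_for (Measure.type T R) dens
    (isMeasure.Build _ _ _ dens dens0 dens_ge0 dens_sigma_additive).
by exists D.
Qed.

End density_measure.

(** Normalization divides by the total mass 1; the Dirac measure is only its fallback for total mass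
    0 or infinity. *)
Lemma probability_of_measure d (T : measurableType d) (R : realType)
    (m : {measure set T -> \bar R}) : m setT = 1%E ->
  exists p : probability T R, forall A, p A = m A.
Proof.
move=> m1; exists (mnormalize m (dirac (point : T)) : probability T R) => A.
by rewrite /= /mnormalize m1 onee_eq0/= invr1 mule1.
Qed.

Section representations.
Context {R : realType}.
Local Notation TR := (measurableTypeR R).

Lemma rho_lam_continuous_rep (lam : R) : continuous_rep (rho_lam lam).
Proof.
split.
- by rewrite /rho_lam /= powR1.
- move=> x y; rewrite /rho_lam posvalM powRM ?ltW ?posval_gt0//.
  by rewrite -scalar_mxM.
- have -> : rho_lam lam = (fun k : R => k *: (1%:M : 'M[R]_1)) \o
      (fun x : posreal R => expR (lam * ln (posval x))).
    apply/funext => x; rewrite /rho_lam /= scalemx1.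
    by rewrite -[in LHS](lnK (posval_gt0 x)) powR_expR.
  move=> x; apply: continuous_comp; last exact: scalel_continuous.
  apply: continuous_comp; last exact: continuous_expR.
  apply: continuousM; first exact: cst_continuous.
  apply: continuous_comp; first exact: posval_continuous.
  by apply: continuous_ln; exact: posval_gt0.
Qed.

Lemma v_one_fixed (lam : R) : fixed_vector (triv R) (rho_lam lam) (v_one R).
Proof.
by move=> _ ->; have [-> _ _] := rho_lam_continuous_rep lam; rewrite mul1mx.
Qed.

(** Composed with the exponential, [tau] is additive on R, and continuity bounds it above on [0, 1];
    hence it is linear. *)
Lemma W0_ln (tau : posreal R -> R) : @W0 R (posreal R) (triv R) tau ->
  exists b, forall g, tau g = b * ln (posval g).
Proof.
move=> [ctau tauM _].
pose u t := tau (posof (expR t)).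
have cu : continuous u.
  move=> t; apply: continuous_comp; last exact: ctau.
  apply: posreal_cvg => {}t.
  rewrite [X in continuous_at _ X](_ : _ = expR); first exact: continuous_expR.
  by apply/funext => y; rewrite /= posofK ?expR_gt0.
have [C _ uC] := EVT_max ler01 (continuous_subspaceT cu).
have uE t : u t = u 1 * t.
  apply: (@additive_bounded_above _ u (u C)).
    move=> x y; rewrite /u -tauM; congr tau; apply: (can_inj (@posvalK R)).
    by rewrite posvalM !posofK ?expR_gt0// expRD.
  by move=> x x01; apply: uC; rewrite in_itv.
exists (u 1) => g; rewrite -uE /u lnK ?posvalK// posrE; exact: posval_gt0.
Qed.

Lemma ln_W0 (b : R) : @W0 R (posreal R) (triv R) (fun g => b * ln (posval g)).
Proof.
split.
- move=> x; apply: (@cvgM _ _ (nbhs x) _ (cst b)); first exact: cvg_cst.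
  apply: continuous_comp; first exact: posval_continuous.
  by apply: continuous_ln; exact: posval_gt0.
- by move=> x y; rewrite posvalM lnM ?posrE ?posval_gt0// mulrDr.
- by move=> _ ->; rewrite ln1 mulr0.
Qed.

Lemma exists_dual (a : R) :
  exists phi : {linear 'cV[R]_1 -> R^o}, phi (v_one R) = a.
Proof.
pose f (v : 'cV[R]_1) : R^o := a * v 0 0.
have lf : linear f by move=> k u v; rewrite /f !mxE mulrDr mulrCA.
pose phi : {linear 'cV[R]_1 -> R^o} :=
  HB.pack f (GRing.isLinear.Build _ _ _ _ f lf).
by exists phi; rewrite /= /f /v_one mxE mulr1.
Qed.

End representations.

(** * The family *)

Section gamma_family.
Context {R : realType}.
Local Notation mu := (@lebesgue_measure R).
Local Notation TR := (measurableTypeR R).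
Local Notation X := (homogeneous_space (triv R)).

Lemma gen_gamma_weight (lam k theta x : R) : 0 < theta -> 0 < x ->
  gen_gamma_pdf lam k theta x =
  `|lam| / Gamma k * theta `^ (- (k * lam))
    * weight lam (theta `^ (- lam)) (k * lam) x.
Proof.
move=> th0 x0; have ith0 : 0 <= theta^-1 by rewrite invr_ge0 ltW.
have thV p : theta^-1 `^ p = theta `^ (- p).
  by rewrite -powR_inv1 ?ltW// -powRrM mulN1r.
rewrite /gen_gamma_pdf /weight !powRM ?(ltW x0)// !thV powRD ?(gt_eqF x0)
  ?implybT//.
by rewrite powR_inv1 ?(ltW x0)// [x `^ lam * _]mulrC; ring.
Qed.

Lemma integral_gen_gamma_weight (lam k theta : R) (B : set TR) :
  0 < theta -> measurable B -> B `<=` `]0, +oo[%classic -> 0 < k ->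
  (\int[mu]_(x in B) (gen_gamma_pdf lam k theta x)%:E =
   (`|lam| / Gamma k * theta `^ (- (k * lam)))%:E *
   \int[mu]_(x in B) (weight lam (theta `^ (- lam)) (k * lam) x)%:E)%E.
Proof.
move=> th0 mB B0 k0; rewrite -ge0_integralZl_EFin//; last 3 first.
- by move=> x _; rewrite lee_fin weight_ge0.
- by apply: measurable_funTS; apply/measurable_EFinP; exact: measurable_weight.
- by rewrite !mulr_ge0 ?powR_ge0 ?invr_ge0//; exact/ltW/Gamma_gt0.
apply: eq_integral => x /set_mem/B0; rewrite /= in_itv/= andbT => x0.
by rewrite gen_gamma_weight.
Qed.

Lemma integral_weight_theta (lam k theta : R) : lam != 0 -> 0 < k ->
  0 < theta ->
  (\int[mu]_(x in `]0%R, +oo[) (weight lam (theta `^ (- lam)) (k * lam) x)%:E =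
   (`|lam| / Gamma k * theta `^ (- (k * lam)))^-1%:E)%E.
Proof.
move=> lam0 k0 th0; rewrite integral_weight// ?powR_gt0// Gamma_integralE//.
by rewrite -EFinM -powRrM mulrNN [k * lam]mulrC powRN !invfM !invrK mulrAC.
Qed.

Lemma integral_gen_gamma_pdf (lam k theta : R) : lam != 0 -> 0 < k ->
  0 < theta ->
  (\int[mu]_(x in `]0%R, +oo[) (gen_gamma_pdf lam k theta x)%:E = 1)%E.
Proof.
move=> lam0 k0 th0; rewrite integral_gen_gamma_weight//.
rewrite integral_weight_theta// -EFinM mulfV// !mulf_neq0 ?normr_eq0
  ?invr_eq0//.
  by rewrite gt_eqF// Gamma_gt0.
by rewrite gt_eqF// powR_gt0.
Qed.

(** [density_family] only collects probabilities that exist; this shows that no pair (k, theta) is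
    lost when lam is nonzero. *)
Lemma exists_gen_gamma (lam k theta : R) : lam != 0 -> 0 < k -> 0 < theta ->
  exists q : probability (borel (posreal R)) R,
    has_density q (gen_gamma_pdf lam k theta).
Proof.
move=> lam0 k0 th0.
pose w := weight lam (theta `^ (- lam)) (k * lam).
pose K := `|lam| / Gamma k * theta `^ (- (k * lam)).
have K0 : 0 <= K by rewrite !mulr_ge0 ?powR_ge0 ?invr_ge0//;
  exact/ltW/Gamma_gt0.
pose f : TR -> \bar R := (fun x : TR => (K * w x)%:E) \_ `]0, +oo[%classic.
have mf : measurable_fun setT f.
  apply/(measurable_restrictT _ _).1; first exact: measurable_itv.
  by apply: measurable_funTS; apply/measurable_EFinP;
    apply: measurable_funM => //; exact: measurable_weight.
have f0 x : (0 <= f x)%E.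
  by rewrite /f patchE; case: ifP => // _;
    rewrite lee_fin mulr_ge0// weight_ge0.
have [D DE] := density_measure mu mf f0.
pose m := image_measure D (@measurable_posof R).
have mE A : measurable A -> m A = dx_density (gen_gamma_pdf lam k theta) A.
  move=> mA; rewrite /dx_density posval_imageE.
  transitivity (D (posof @^-1` A)); first by [].
  rewrite DE -integral_mkcondr; apply: eq_integral => x /set_mem[_].
  by rewrite /= in_itv/= andbT => x0; rewrite gen_gamma_weight.
have m1 : m setT = 1%E.
  rewrite mE//; rewrite /dx_density posval_imageE preimage_setT setTI.
  exact: integral_gen_gamma_pdf.
have [q qE] := probability_of_measure m1.
by exists q => A mA; rewrite qE mE.
Qed.

Variables (nu : {measure set (borel X) -> \bar R}) (c s : R).
Hypothesis c0 : 0 < c.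
Hypothesis nuE : forall F : R -> \bar R, measurable_fun [set: R] F ->
  (forall x, 0 <= F x)%E ->
  (\int[nu]_x F (coset_val x) =
   c%:E * \int[mu]_(z in `]0%R, +oo[) (F z * (z `^ (s - 1))%:E))%E.

Lemma method_unnormalizedE (lam : R) (phi : {linear 'cV[R]_1 -> R^o})
    (tau : posreal R -> R) (b : R) (A : set (borel X)) :
  (forall g, tau g = b * ln (posval g)) -> measurable A ->
  (method_unnormalized nu (rho_lam lam) (v_one R) (phi, tau) A =
   c%:E * \int[mu]_(z in coset_val @` A)
     (weight lam (phi (v_one R)) (b + s) z)%:E)%E.
Proof.
move=> tauE mA; have mB := measurable_coset_val_image mA.
set B := coset_val @` A in mB *; set a := phi (v_one R).
have B0 : B `<=` `]0, +oo[%classic.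
  by move=> _ [x _ <-]; rewrite /= in_itv/= coset_val_gt0.
(* The parameter b + 1 makes the power in the weight equal to b, the contribution of [tau]; the
   remaining s - 1 is supplied by [nuE]. *)
pose F : TR -> \bar R := (fun z : TR => (weight lam a (b + 1) z)%:E) \_ B.
have mF : measurable_fun setT F.
  apply/(measurable_restrictT _ _).1 => //.
  by apply: measurable_funTS; apply/measurable_EFinP; exact: measurable_weight.
have F0 z : (0 <= F z)%E.
  by rewrite /F patchE; case: ifP => // _; rewrite lee_fin weight_ge0.
transitivity (\int[nu]_x F (coset_val x))%E.
  rewrite /method_unnormalized integral_mkcond; apply: eq_integral => x _.
  rewrite /F !patchE; have -> : (coset_val x \in B) = (x \in A).
    apply/idP/idP => /set_mem Bx; apply/mem_set; last by exists x.
    by case: Bx => y Ay /(can_inj (@coset_valK R)) <-.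
  case: ifP => // _; congr EFin; rewrite /method_density /weight /=.
  have x0 := coset_val_gt0 x.
  rewrite expRD addrK tauE -/(coset_val x) /rho_lam -/(coset_val x)
    mul_scalar_mx linearZ/=.
  have -> : coset_val x `^ b = expR (b * ln (coset_val x)).
    by rewrite -powR_expR lnK.
  by rewrite [a * _]mulrC.
rewrite nuE//; congr (_ * _)%E;
  rewrite [LHS]integral_mkcond [RHS]integral_mkcond.
apply: eq_integral => z _; rewrite /F !patchE.
case: (boolP (z \in B)) => [/set_mem/B0 z0|_]; last by rewrite mul0e if_same.
rewrite mem_set//; move: z0; rewrite /= in_itv/= andbT => z0.
rewrite -EFinM /weight -mulrA -powRD ?(gt_eqF z0) ?implybT//.
by congr (_ * _ `^ _)%:E; ring.
Qed.

(** The factor c cancels between numerator and total mass, and the shift by s in [tau] cancels the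
    exponent of [nu], so the resulting density is free of both. *)
Lemma method_pE (lam k theta : R) (phi : {linear 'cV[R]_1 -> R^o})
    (tau : posreal R -> R) (A : set (borel X)) :
  lam != 0 -> 0 < k -> 0 < theta -> phi (v_one R) = theta `^ (- lam) ->
  (forall g, tau g = (k * lam - s) * ln (posval g)) -> measurable A ->
  (method_unnormalized nu (rho_lam lam) (v_one R) (phi, tau) setT < +oo)%E /\
  method_p nu (rho_lam lam) (v_one R) (phi, tau) A =
    (\int[mu]_(z in coset_val @` A) (gen_gamma_pdf lam k theta z)%:E)%E.
Proof.
move=> lam0 k0 th0 phiE tauE mA.
have cT : coset_val @` [set: X] = `]0, +oo[%classic.
  by rewrite coset_val_imageE preimage_setT setTI.
rewrite /method_p !(method_unnormalizedE _ _ tauE)// subrK phiE cT.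
rewrite integral_weight_theta// -EFinM; split; first by rewrite ltry.
rewrite integral_gen_gamma_weight//; last 2 first.
- exact: measurable_coset_val_image.
- by move=> _ [x _ <-]; rewrite /= in_itv/= coset_val_gt0.
rewrite muleA /= -EFinM; congr (_%:E * _)%E.
by rewrite invfM invrK mulrAC mulVf ?gt_eqF// mul1r.
Qed.

End gamma_family.

(** * Equality of the two families and the special cases *)

Lemma eq_density_family (R : realType) (f g : R -> R -> R -> R) :
  (forall k theta x, 0 < theta -> 0 < x -> f k theta x = g k theta x) ->
  density_family f = density_family g.
Proof.
move=> fg; have dx_eq k theta A : 0 < theta ->
    dx_density (f k theta) A = dx_density (g k theta) A.
  move=> th0; apply: eq_integral => _ /set_mem[x _ <-].
  by rewrite fg// posval_gt0.
apply/seteqP; split => q [k [theta [k0 th0 qE]]]; exists k, theta;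
by split => // A mA; rewrite qE// dx_eq.
Qed.

Lemma on_group_method_family (R : realType) (lam : R)
    (nu : {measure set (borel (homogeneous_space (triv R))) -> \bar R}) :
  admissible nu ->
  on_group (method_family nu (rho_lam lam) (v_one R)) =
  density_family (gen_gamma_pdf lam).
Proof.
move=> /admissible_integral[c [s [c0 nuE]]]; apply/seteqP; split => q.
  move=> [p [[phi tau] [/= tauW Uoo] pE] qE].
  have [b tauE] := W0_ln tauW.
  have cT : coset_val @` [set: homogeneous_space (triv R)] = `]0, +oo[%classic.
    by rewrite coset_val_imageE preimage_setT setTI.
  move: (Uoo); rewrite (method_unnormalizedE nuE _ _ tauE)// cT => Uoo'.
  have [lam0 phi0 k0] : [/\ lam != 0, 0 < phi (v_one R) & 0 < (b + s) / lam].
    (* Since c > 0, an infinite integral of the weight would make the unnormalized mass infinite. *)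
    apply: integral_weight_fin; move: Uoo'.
    by rewrite !ltey; apply: contra => /eqP ->; rewrite gt0_muley// lte_fin.
  set k := (b + s) / lam in k0.
  pose theta := phi (v_one R) `^ (- lam^-1).
  have th0 : 0 < theta by rewrite powR_gt0.
  have phiE : phi (v_one R) = theta `^ (- lam).
    by rewrite /theta -powRrM mulrNN mulVf// powRr1// ltW.
  have tauE' g : tau g = (k * lam - s) * ln (posval g) by rewrite divfK// addrK.
  exists k, theta; split => // A mA.
  have mB : measurable
      (repr @^-1` A : set (borel (homogeneous_space (triv R)))).
    by rewrite -[X in measurable X]setTI; exact: measurable_coset_repr.
  transitivity (p (repr @^-1` A)).
    rewrite qE// /pushforward; congr (q _).
    by apply/seteqP; split => g; rewrite /preimage/= coset_piK.
  rewrite pE// (method_pE c0 nuE lam0 k0 th0 phiE tauE' mB).2//; congr integral.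
  apply/seteqP; split => [_ [x Ax <-]|_ [g Ag <-]]; first by exists (repr x).
  by exists (coset_pi (triv R) g); rewrite /preimage/coset_val/= coset_piK.
move=> [k [theta [k0 th0 qE]]].
(* For lam = 0 the density vanishes identically and cannot have total mass 1. *)
have lam0 : lam != 0.
  apply/negP => /eqP lam0; have := qE setT measurableT.
  rewrite probability_setT /dx_density integral0_eq => [/eqP|x _];
    first by rewrite onee_eq0.
  by rewrite /gen_gamma_pdf lam0 normr0 !mul0r.
have [phi phiE] := exists_dual (theta `^ (- lam)).
pose tau g := (k * lam - s) * ln (posval g).
(* The member of the family on X is the image of q under g -> gH. *)
pose m := image_measure q (@measurable_coset_pi R).
have [p pE] : exists p : probability (borel (homogeneous_space (triv R))) R,
    forall A, p A = m A.
  by apply: probability_of_measure; exact: probability_setT.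
exists p; last by move=> B _; rewrite pE.
exists (phi, tau) => [|A mA].
  split; first exact: ln_W0.
  by have [] := @method_pE _ nu c s c0 nuE lam k theta phi tau setT lam0 k0
    th0 phiE (fun=> erefl) measurableT.
rewrite (method_pE c0 nuE lam0 k0 th0 phiE (fun=> erefl) mA).2 pE.
transitivity (q (coset_pi (triv R) @^-1` A)); first by [].
rewrite qE; last first.
  by rewrite -[X in measurable X]setTI; exact: measurable_coset_pi.
congr integral; apply/seteqP; split => [_ [g Ag <-]|_ [x Ax <-]].
  by exists (coset_pi (triv R) g) => //; rewrite /coset_val coset_piK.
by exists (repr x) => //; rewrite /preimage/= coset_reprK.
Qed.

(** The existence clauses keep the equality of families from being vacuous: an admissible [nu]
    exists, and for lam nonzero every (k, theta) is attained. For lam = 0 both families are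
    empty. *)
Theorem proposition4p7 (R : realType) (lam : R) :
  [/\ continuous_rep (rho_lam lam),
      fixed_vector (triv R) (rho_lam lam) (v_one R),
      exists nu : {measure set (borel (homogeneous_space (triv R))) -> \bar R},
        admissible nu
    & forall nu : {measure set (borel (homogeneous_space (triv R))) -> \bar R},
        admissible nu ->
        let P := on_group (method_family nu (rho_lam lam) (v_one R)) in
        [/\ P = density_family (gen_gamma_pdf lam),
            lam != 0 -> forall k theta : R, 0 < k -> 0 < theta ->
              exists2 q, P q & has_density q (gen_gamma_pdf lam k theta),
            lam = 1 -> P = density_family (@gamma_pdf R)
          & lam = - 1 -> P = density_family (@inv_gamma_pdf R)]].
Proof.
split.
- exact: rho_lam_continuous_rep.
- exact: v_one_fixed.
- exact: exists_admissible.
move=> nu admissible_nu P.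
have PE : P = density_family (gen_gamma_pdf lam).
  exact: on_group_method_family.
rewrite {}PE; split; first by [].
- move=> lam0 k theta k0 th0; have [q qE] := exists_gen_gamma lam0 k0 th0.
  by exists q => //; exists k, theta.
- move=> ->; apply: eq_density_family => k theta x th0 x0.
  rewrite /gen_gamma_pdf /gamma_pdf normr1 mul1r mulr1 powRr1//.
  by rewrite ltW// divr_gt0.
- move=> ->; apply: eq_density_family => k theta x th0 x0.
  have xth0 : 0 <= x / theta by rewrite ltW// divr_gt0.
  rewrite /gen_gamma_pdf /inv_gamma_pdf normrN normr1 mul1r [k * _]mulrC powRrM.
  by rewrite powR_inv1// invf_div.
Qed.
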